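(* Let $\alpha\in(0,1)$. In the model described in the context (including the $\phi$-mixing, boundedness/moment and sampling assumptions (A1), (A2), (A3) listed there), if $n\geqslant\max(d,\tau)$, then with probability larger than $1-\alpha$, $$\|\widehat{\mathbf\Theta}-\mathbf\Theta^0\|_{\mathcal F,\Pi}^2\leqslant4\min_{k\in\mathcal K}\left\{3\min_{\mathbf T\in\mathcal S_k}\|(\mathbf T-\mathbf T^0)\mathbf\Lambda\|_{\mathcal F,\Pi}^2+\mathfrak c_{1}k(d+\tau)\frac{\log(n)}{n}\right\}+\frac{\mathfrak c_{1}}{n}\log\left(\frac{4k^*}{\alpha}\right)+\frac{\mathfrak c_{2}}{n},$$ where $$\mathfrak c_1=4\mathfrak c_{\mathrm{rb}}+16\mathfrak c_{\mathrm{pen}}+72\mathfrak m_0\mathfrak c_\xi\quad\text{and}\quad\mathfrak c_2=9\mathfrak b_2\mathfrak m_0,$$ with the constants $\mathfrak c_{\mathrm{rb}},\mathfrak c_{\mathrm{pen}},\mathfrak b_2$ defined in the context.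
   Context: Model. Let $d,T\in\mathbb N^*$, $\tau\in\{1,\dots,T\}$ and $n\in\{1,\dots,dT\}$. $\mathcal M_{p,q}(\mathbb K)$ is the set of $p\times q$ matrices over $\mathbb K$, and $\langle\mathbf A,\mathbf B\rangle_{\mathcal F}=\mathrm{trace}(\mathbf A^*\mathbf B)=\sum_{j,t}\mathbf A_{j,t}\mathbf B_{j,t}$ on $\mathcal M_{d,T}(\mathbb R)$. One observes $\mathbf X_1,\dots,\mathbf X_n$ and $$Y_i=\mathrm{trace}(\mathbf X_i^*\mathbf M)+\xi_i,\quad i=1,\dots,n,\qquad \mathbf M=\mathbf\Theta^0+\varepsilon,\qquad\mathbf\Theta^0=\mathbf T^0\mathbf\Lambda.$$ Here $\mathbf X_1,\dots,\mathbf X_n$ are i.i.d. random matrices with common distribution $\Pi$ on $\mathcal X=\{e_{\mathbb R^d}(j)e_{\mathbb R^T}(t)^*:1\leqslant j\leqslant d,\ 1\leqslant t\leqslant T\}$ (with $e_{\mathbb R^p}(j)$ the $j$-th canonical basis vector of $\mathbb R^p$); $\xi_1,\dots,\xi_n$ are i.i.d. centered real random variables with standard deviation $\sigma_\xi>0$; $\varepsilon$ is a $d\times T$ real random matrix with i.i.d. centered rows $\varepsilon_{1,.},\dots,\varepsilon_{d,.}$; the families $(\mathbf X_i)_i$, $(\xi_i)_i$ and $\varepsilon$ are mutually independent. $\mathbf\Lambda\in\mathcal M_{\tau,T}(\mathbb C)$ is known and deterministic (the products $\mathbf T\mathbf\Lambda$ appearing below are real matrices), and $\mathfrak m_{\mathbf\Lambda}:=\sup_{j,t}|\mathbf\Lambda_{j,t}|$.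 $\mathfrak m_{\mathbf\Lambda}(\tau)$ is a finite number with $$1\vee\sup_{\mathbf T\in\mathcal M_{d,\tau}(\mathbb R),\,\mathbf T\neq0}\frac{\sup_{j,t}|(\mathbf T\mathbf\Lambda)_{j,t}|}{\sup_{j,\ell}|\mathbf T_{j,\ell}|}\leqslant\mathfrak m_{\mathbf\Lambda}(\tau)<\infty.$$ $\mathbf T^0\in\mathcal M_{d,\tau}(\mathbb R)$ is unknown, deterministic, of some (unknown) rank in $\{1,\dots,d\wedge T\}$, with $\sup_{j,t}|\mathbf T^0_{j,t}|\leqslant\mathfrak m_0/\mathfrak m_{\mathbf\Lambda}(\tau)$, $\mathfrak m_0>0$. Norm. $\|\mathbf A\|_{\mathcal F,\Pi}^2=\int\langle X,\mathbf A\rangle_{\mathcal F}^2\,\Pi(dX)$ for $\mathbf A\in\mathcal M_{d,T}(\mathbb R)$ (for random $\mathbf A$ it is evaluated pointwise). Mixing coefficients. For $\sigma$-algebras $\mathcal A,\mathcal B$, $\phi(\mathcal A,\mathcal B)=\sup\{|\mathbb P(B)-\mathbb P(B|A)|:(A,B)\in\mathcal A\times\mathcal B,\ \mathbb P(A)\neq0\}$; for a process $Z=(Z_t)_{t\in\mathbb Z}$, $\phi_Z(i)=\sup_{t\in\mathbb Z}\phi(\sigma(Z_h,h\leqslant t),\sigma(Z_\ell,\ell\geqslant t+i))$. Assumptions. (A1) The rows of $\varepsilon$ are i.i.d., and there is a process $(\varepsilon_t)_{t\in\mathbb Z}$, with mixing coefficients $\phi_\varepsilon(i)$, such that each row $\varepsilon_{j,.}$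 has the same distribution as $(\varepsilon_1,\dots,\varepsilon_T)$ and $\Phi_\varepsilon:=1+\sum_{i=1}^T\phi_\varepsilon(i)^{1/2}<\infty$. (A2) There is a deterministic $\mathfrak m_\varepsilon>0$ with $\sup_{j,t}|\varepsilon_{j,t}|\leqslant\mathfrak m_\varepsilon$, and there are deterministic $\mathfrak c_\xi,\mathfrak v_\xi>0$ with $\sup_i\mathbb E(\xi_i^2)\leqslant\mathfrak v_\xi$ and $\sup_i\mathbb E(|\xi_i|^q)\leqslant\mathfrak v_\xi\mathfrak c_\xi^{q-2}q!/2$ for every integer $q\geqslant3$. (A3) There is $\mathfrak c_\Pi>0$ with $\Pi(\{e_{\mathbb R^d}(j)e_{\mathbb R^T}(t)^*\})\leqslant\mathfrak c_\Pi/(dT)$ for all $(j,t)\in\{1,\dots,d\}\times\{1,\dots,T\}$. Constants. $$\mathfrak a=4\max\{4\mathfrak m_0^2,4\mathfrak v_\xi,4\mathfrak m_\varepsilon^2,2\mathfrak m_\varepsilon^2\Phi_\varepsilon^2\mathfrak c_\Pi\},\quad\lambda^*=(16\mathfrak m_0\max\{\mathfrak m_0,\mathfrak m_\varepsilon,\mathfrak c_\xi\})^{-1},$$ $$\mathfrak b_1=32\left(\frac1{\mathfrak a}\wedge\lambda^*\right)^{-1},\quad\mathfrak b_2=4\mathfrak m_{\mathbf\Lambda}\left(\mathfrak v_\xi^{1/2}+\frac{\mathfrak v_\xi}{2\mathfrak c_\xi}+\mathfrak m_\varepsilon+3\mathfrak m_0\right),$$ $$\mathfrak c_{\mathrm{rb}}=72\mathfrak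 m_0\mathfrak m_{\mathbf\Lambda}\mathfrak c_\xi+5\mathfrak b_1+9\mathfrak m_0\mathfrak b_2,\quad\mathfrak c_{\mathrm{pen}}=2\left(\frac1{\mathfrak a}\wedge\lambda^*\right)^{-1}.$$ Adaptive estimator. For $k\in\mathbb N^*$, $\mathcal M_{d,k,\tau}$ is the set of products $\mathbf U\mathbf V$ with $\mathbf U\in\mathcal M_{d,k}(\mathbb R)$, $\mathbf V\in\mathcal M_{k,\tau}(\mathbb R)$ whose entries are all bounded in absolute value by $\sqrt{\mathfrak m_0/(k\,\mathfrak m_{\mathbf\Lambda}(\tau))}$. Let $\mathcal K=\{1,\dots,k^*\}\subset\mathbb N^*$ and, for each $k\in\mathcal K$, let $\mathcal S_k$ be a given subset of $\mathcal M_{d,k,\tau}$ (the minima over $\mathcal S_k$ written here are taken to exist). With $r_n(\mathbf A)=\frac1n\sum_{i=1}^n(Y_i-\langle\mathbf X_i,\mathbf A\rangle_{\mathcal F})^2$, let $\widehat{\mathbf T}_k\in\arg\min_{\mathbf T\in\mathcal S_k}r_n(\mathbf T\mathbf\Lambda)$ and $$\widehat k\in\arg\min_{k\in\mathcal K}\{r_n(\widehat{\mathbf T}_k\mathbf\Lambda)+\mathrm{pen}(k)\},\qquad\mathrm{pen}(k)=16\,\mathfrak c_{\mathrm{pen}}\frac{\log(n)}{n}k(d+\tau).$$ Finally $\widehat{\mathbf\Theta}=\widehat{\mathbf T}_{\widehat k}\mathbf\Lambda$. *)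

(* Defs.v *)
From HB Require Import structures.
From mathcomp Require Import all_boot all_order all_algebra.
From mathcomp Require Import all_classical all_reals all_analysis.
From mathcomp Require Import complex.

Set Implicit Arguments.
Unset Strict Implicit.
Unset Printing Implicit Defensive.

Import Order.TTheory GRing.Theory Num.Theory.
Import numFieldNormedType.Exports.

Local Open Scope classical_set_scope.
Local Open Scope ring_scope.

(* The sigma-algebra on Omega generated by the maps Z i, i in D. *)
Definition sigma_gen (I Omega : Type) (d : measure_display)
    (V : measurableType d) (D : set I) (Z : I -> Omega -> V)
    : set_system Omega :=
  <<s \bigcup_(i in D) preimage_set_system [set: Omega] (Z i) measurable >>.

(* Matrices carry the sigma-algebra generated by their entries; over a realType
   this is the Borel sigma-algebra, so that a random matrix is a
   {RV P >-> 'M[R]_(m, n)}. *)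
Definition measure_matrix_display : measure_display -> measure_display.
Proof. exact. Qed.

Section measurable_matrix.
Context (d : measure_display) (V : measurableType d) (m n : nat).

Definition measurable_mx : set_system 'M[V]_(m, n) :=
  sigma_gen [set: 'I_m * 'I_n] (fun ij (A : 'M[V]_(m, n)) => A ij.1 ij.2).

Let measurable_mx0 : measurable_mx set0.
Proof. exact: sigma_algebra0. Qed.

Let measurable_mxC A : measurable_mx A -> measurable_mx (~` A).
Proof. exact: sigma_algebraC. Qed.

Let measurable_mx_bigcup (F : (set 'M[V]_(m, n))^nat) :
  (forall i, measurable_mx (F i)) -> measurable_mx (\bigcup_i F i).
Proof. exact: sigma_algebra_bigcup. Qed.

HB.instance Definition _ :=
  @isMeasurable.Build (measure_matrix_display d) 'M[V]_(m, n)
    measurable_mx measurable_mx0 measurable_mxC measurable_mx_bigcup.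

End measurable_matrix.

Definition mutually_indep (d : measure_display) (Omega : measurableType d)
    (R : realType) (P : probability Omega R) (I : finType)
    (F : I -> set_system Omega) : Prop :=
  forall (J : {set I}) (A : I -> set Omega),
    (forall i, i \in J -> F i (A i)) ->
    P (\bigcap_(i in [set` J]) A i) = (\prod_(i in J) P (A i))%E.

(* The law of f under P is the law of g under Q. *)
Definition same_law (d1 d2 d : measure_display) (O1 : measurableType d1)
    (O2 : measurableType d2) (V : measurableType d) (R : realType)
    (P : probability O1 R) (f : O1 -> V)
    (Q : probability O2 R) (g : O2 -> V) : Prop :=
  forall A : set V, measurable A -> P (f @^-1` A) = Q (g @^-1` A).

Definition iid (d d' : measure_display) (Omega : measurableType d)
    (V : measurableType d') (R : realType) (P : probability Omega R)
    (I : finType) (Z : I -> Omega -> V) : Prop :=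
  mutually_indep P (fun i => g_sigma_algebra_preimage (Z i)) /\
  (forall i j, same_law P (Z i) P (Z j)).

(* The sets under both real suprema below are nonempty and contained in [0, 1],
   so that each [sup] is a genuine least upper bound. *)
Definition phi_coef (d : measure_display) (Omega : measurableType d)
    (R : realType) (P : probability Omega R) (FA FB : set_system Omega) : R :=
  sup [set x : R | exists A B : set Omega, [/\ FA A, FB B, P A != 0%E &
    x = `|fine (P B) - fine (P (A `&` B)) / fine (P A)|]].

Definition phi_mixing (d : measure_display) (Omega : measurableType d)
    (R : realType) (P : probability Omega R) (Z : int -> Omega -> R)
    (i : nat) : R :=
  sup [set phi_coef P (sigma_gen [set h : int | h <= t] Z)
                      (sigma_gen [set l : int | t + i%:Z <= l] Z)
      | t in [set: int]].

(* Phi is a finite sum of numbers of [0, 1]: its finiteness is automatic. *)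
Definition mixing_sum (d : measure_display) (Omega : measurableType d)
    (R : realType) (P : probability Omega R) (Z : int -> Omega -> R)
    (T : nat) : R :=
  1 + \sum_(1 <= i < T.+1) Num.sqrt (phi_mixing P Z i).

Definition frob (R : realType) (d T : nat) (A B : 'M[R]_(d, T)) : R :=
  \tr (A^T *m B).

Definition basis_mx (R : realType) (d T : nat) : set 'M[R]_(d, T) :=
  [set delta_mx jt.1 jt.2 | jt in [set: 'I_d * 'I_T]].

Definition normPi2 (R : realType) (d T : nat)
    (Pi : probability 'M[R]_(d, T) R) (A : 'M[R]_(d, T)) : R :=
  \int[Pi]_X (frob X A ^+ 2).

Definition cprod (R : realType) (d tau T : nat) (U : 'M[R]_(d, tau))
    (L : 'M[R[i]]_(tau, T)) : 'M[R[i]]_(d, T) :=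
  map_mx (real_complex R) U *m L.

Definition real_mx (R : realType) (m n : nat) (A : 'M[R[i]]_(m, n)) : Prop :=
  forall i j, complex.Im (A i j) = 0.

(* The product U L seen as a real matrix; meaningful when real_mx (cprod U L). *)
Definition rprod (R : realType) (d tau T : nat) (U : 'M[R]_(d, tau))
    (L : 'M[R[i]]_(tau, T)) : 'M[R]_(d, T) :=
  map_mx (@complex.Re R) (cprod U L).

(* Largest modulus of the entries of a complex matrix; for a real matrix this
   quantity is the library norm `|A|. *)
Definition cmx_norm (R : realType) (m n : nat) (A : 'M[R[i]]_(m, n)) : R :=
  `|map_mx (@ComplexField.Normc.normc R) A|.

Definition entry_ratio_sup (R : realType) (d tau T : nat)
    (L : 'M[R[i]]_(tau, T)) : \bar R :=
  ereal_sup [set (cmx_norm (cprod U L) / `|U|)%:E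
            | U in [set U : 'M[R]_(d, tau) | U != 0]].

(* The class M_{d,k,tau}; mLt stands for m_Lambda(tau). *)
Definition factor_class (R : realType) (d k tau : nat) (m0 mLt : R)
    : set 'M[R]_(d, tau) :=
  [set A | exists (U : 'M[R]_(d, k)) (V : 'M[R]_(k, tau)),
    [/\ A = U *m V,
        forall j l, `|U j l| <= Num.sqrt (m0 / (k%:R * mLt)) &
        forall l t, `|V l t| <= Num.sqrt (m0 / (k%:R * mLt))]].

Definition emp_risk (R : realType) (d T n : nat) (X : 'I_n -> 'M[R]_(d, T))
    (Y : 'I_n -> R) (A : 'M[R]_(d, T)) : R :=
  n%:R^-1 * \sum_(i < n) (Y i - frob (X i) A) ^+ 2.

Definition is_argmin (R : realType) (E : Type) (D : set E) (f : E -> R)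
    (x : E) : Prop :=
  D x /\ (forall y, D y -> f x <= f y).

(* A minimum whenever it is attained, i.e. when is_argmin D f x for some x. *)
Definition min_over (R : realType) (E : Type) (D : set E) (f : E -> R) : R :=
  inf [set f x | x in D].

Definition ranks (kstar : nat) : set nat := [set k | (1 <= k <= kstar)%N].

(* Parameters of the constants: m0, meps, cxi, vxi, cPi are the constants of
   the model, mL = m_Lambda and Phi = Phi_epsilon. *)
Definition cst_a (R : realType) (m0 meps vxi cPi Phi : R) : R :=
  4 * Num.max (Num.max (4 * m0 ^+ 2) (4 * vxi))
              (Num.max (4 * meps ^+ 2) (2 * meps ^+ 2 * Phi ^+ 2 * cPi)).

Definition cst_lambda (R : realType) (m0 meps cxi : R) : R :=
  (16 * m0 * Num.max m0 (Num.max meps cxi))^-1.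

Definition cst_b1 (R : realType) (m0 meps cxi vxi cPi Phi : R) : R :=
  32 * (Num.min (1 / cst_a m0 meps vxi cPi Phi) (cst_lambda m0 meps cxi))^-1.

Definition cst_b2 (R : realType) (mL m0 meps cxi vxi : R) : R :=
  4 * mL * (Num.sqrt vxi + vxi / (2 * cxi) + meps + 3 * m0).

Definition cst_rb (R : realType) (mL m0 meps cxi vxi cPi Phi : R) : R :=
  72 * m0 * mL * cxi + 5 * cst_b1 m0 meps cxi vxi cPi Phi
  + 9 * m0 * cst_b2 mL m0 meps cxi vxi.

Definition cst_pen (R : realType) (m0 meps cxi vxi cPi Phi : R) : R :=
  2 * (Num.min (1 / cst_a m0 meps vxi cPi Phi) (cst_lambda m0 meps cxi))^-1.

Definition cst_1 (R : realType) (mL m0 meps cxi vxi cPi Phi : R) : R :=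
  4 * cst_rb mL m0 meps cxi vxi cPi Phi
  + 16 * cst_pen m0 meps cxi vxi cPi Phi + 72 * m0 * cxi.

Definition cst_2 (R : realType) (mL m0 meps cxi vxi : R) : R :=
  9 * cst_b2 mL m0 meps cxi vxi * m0.

Definition penalty (R : realType) (cpen : R) (n d tau k : nat) : R :=
  16 * cpen * (ln n%:R / n%:R) * k%:R * (d + tau)%:R.

(* Main.v *)
Require Import Defs.
From mathcomp Require Import all_boot all_order all_algebra.
From mathcomp Require Import all_classical all_reals all_analysis.
From mathcomp Require Import finmap measurable_realfun.
From mathcomp Require Import complex.
From mathcomp Require Import zify ring lra.

Import Order.TTheory GRing.Theory Num.Theory.
Import numFieldNormedType.Exports.

(** For a fixed matrix [D = A - Theta0], let [excess D] be [n] times the decrease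
    of the empirical risk from [Theta0] to [A], and [N D] the squared
    [Pi]-seminorm. With [mu = 1 / (16 L)] and [L] the inverse of
    [min (1 / a) lambda*], for each sign [s],
      [E exp (s mu excess D) <= exp (n mu N D (1/2 - s))].
    Indeed [X] takes finitely many values; conditioning on them, the noise [xi] is
    integrated by Bernstein's condition, the [n] draws give an [n]-th power, and
    what remains is the exponential moment of a linear form in [eps], whose rows
    are independent and phi-mixing. The latter is bounded without conditional
    expectations: [exp (S_k)] is telescoped over its past and each term is handled
    by the covariance inequality [|E (U V)| <= 2 m phi E |U|].
    Markov's inequality with [s = 1] on a grid of [n ^ (k (d + tau))] factorized
    matrices, and with [s = -1] at the oracle of each class, then yields the
    oracle inequality; the penalty absorbs the logarithm of the size of the grid
    and the grid has mesh [2 m0 / n], so the discretization costs [O(L / n)]. *)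

Set Implicit Arguments.
Unset Strict Implicit.
Unset Printing Implicit Defensive.

Local Open Scope classical_set_scope.
Local Open Scope ring_scope.

(** * Expectation of products of independent variables *)

(** Two obstacles shape the proof. First, the matrix [eps] is shared by all observations, so the
    summands of [excess] are not independent: they become so only once [eps] is frozen. Hence the
    draws are summed out before [eps] is integrated, and they leave [n] times a linear form in [eps]
    whose coefficients carry the sampling weights. Its exponential moment is quadratic in [n], but
    one factor [n * weight] is at most [cPi] by (A3) and [n <= d * T], so the exponent remains of
    the order of [n * mu * N D], like the main term. Second, the estimator is an arbitrary selection
    of minimizers, with no measurability given. All exceptional events are therefore attached to
    deterministic matrices (net points and oracles) or to the noise alone, and the estimator enters
    only pathwise, outside a measurable exceptional set. *)

Lemma lee_prod (R : realDomainType) (I : Type) (s : seq I) (f g : I -> \bar R) :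
  (forall i, 0 <= f i)%E -> (forall i, f i <= g i)%E ->
  (\prod_(i <- s) f i <= \prod_(i <- s) g i)%E.
Proof.
move=> f0 fg; suff /andP[] : ((0 <= \prod_(i <- s) f i)%E &&
    (\prod_(i <- s) f i <= \prod_(i <- s) g i)%E) by [].
elim: s => [|i s /andP[s0 sfg]]; first by rewrite !big_nil lee01 lexx.
by rewrite !big_cons mule_ge0//= lee_pmul.
Qed.

Definition measurable_wrt {Omega : Type} {d : measure_display}
    {V : measurableType d} (F : set_system Omega) (f : Omega -> V) : Prop :=
  forall B, measurable B -> F (f @^-1` B).

Section product_expectation.
Context (d : measure_display) (Omega : measurableType d) (R : realType).
Context (P : probability Omega R).

Import HBNNSimple.

(** The simple approximations are built on the real line and composed with [f], so that their level
    sets are preimages under [f] and thus belong to [F], where the hypothesis on indicators applies;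
    monotone convergence does the rest. The function [g] is the identity on the values of [f]. *)
Lemma integral_mul_indep (F : set_system Omega) (f H : Omega -> R) :
  F `<=` measurable -> measurable_wrt F f ->
  (forall w, 0 <= f w) -> (forall w, 0 <= H w) -> measurable_fun setT H ->
  (forall A, F A ->
     (\int[P]_w (\1_A w * H w)%:E = P A * \int[P]_w (H w)%:E)%E) ->
  (\int[P]_w (H w)%:E < +oo)%E ->
  (\int[P]_w (f w * H w)%:E = \int[P]_w (f w)%:E * \int[P]_w (H w)%:E)%E.
Proof.
move=> Fm fF f0 H0 mH; set h := (\int[P]_w (H w)%:E)%E => AH hoo.
pose g (y : R) : \bar R := (Num.max y 0)%:E.
have mg : measurable_fun [set: R] g.
  by apply/measurable_EFinP; apply: measurable_maxr.
have g0 y : setT y -> (0 <= g y)%E by move=> _; rewrite lee_fin le_max lexx orbT.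
pose s := nnsfun_approx measurableT mg.
have mf : measurable_fun setT f.
  by move=> _ B mB; rewrite setTI; exact/Fm/fF.
have scvg w : (s n (f w))%:E @[n --> \oo] --> (f w)%:E.
  have := cvg_nnsfun_approx measurableT mg g0 (x := f w) I.
  by rewrite /g max_l.
have nds w : nondecreasing_seq (fun n => s n (f w)).
  by move=> a b ab; exact/lefP/nd_nnsfun_approx.
have ms n : measurable_fun setT (fun w => s n (f w)).
  exact: measurableT_comp.
have h0 : (0 <= h)%E by apply: integral_ge0 => w _; rewrite lee_fin.
have mEf : measurable_fun setT (EFin \o f) by apply/measurable_EFinP.
have hfin : h \is a fin_num by rewrite ge0_fin_numE.
have lim1 : (\int[P]_w (f w * H w)%:E)%E =
    limn (fun n => (\int[P]_w (s n (f w) * H w)%:E)%E).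
  rewrite -monotone_convergence //.
  - apply: eq_integral => w _; apply/esym/cvg_lim => //.
    rewrite EFinM; under eq_fun do rewrite EFinM.
    exact: cvgeZr.
  - by move=> n; apply/measurable_EFinP; apply: measurable_funM.
  - by move=> n w _; rewrite lee_fin mulr_ge0.
  - by move=> w _ a b ab; rewrite lee_fin ler_wpM2r // nds.
have lim2 : (\int[P]_w (f w)%:E * h)%E =
    limn (fun n => (\int[P]_w (s n (f w))%:E * h)%E).
  apply/esym/cvg_lim => //; apply: cvgeZr => //.
  have -> : (\int[P]_w (f w)%:E = \int[P]_w limn (fun n => (s n (f w))%:E))%E.
    by apply: eq_integral => w _; exact/esym/cvg_lim.
  apply: cvg_monotone_convergence => //.
  - by move=> n; apply/measurable_EFinP.
  - by move=> n w _; rewrite lee_fin.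
  - by move=> w _ a b ab; rewrite lee_fin nds.
rewrite lim1 lim2; congr (limn _); apply/funext => n.
pose v i := (fset_set (range (s n)))`_i.
have v0 i : (i < #|` fset_set (range (s n))|)%N -> 0 <= v i.
  move=> ilt; have : v i \in fset_set (range (s n)) by exact: mem_nth.
  by rewrite in_fset_set // => /set_mem[w _ <-].
pose A i := f @^-1` (s n @^-1` [set v i]).
have fE w : s n (f w) = \sum_(i < #|` fset_set (range (s n))|) (v i * \1_(A i) w).
  by rewrite [LHS]fimfunEord.
have FA i : F (A i).
  by apply: fF; rewrite -[X in measurable X]setTI; exact: (measurable_funP (s n)).
have mI i : measurable_fun setT (\1_(A i) : Omega -> R).
  by apply: measurable_indic; exact: Fm.
have sE (G : Omega -> R) : (forall w, 0 <= G w) -> measurable_fun setT G ->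
    (\int[P]_w (s n (f w) * G w)%:E =
     \sum_(i < #|` fset_set (range (s n))|)
     ((v i)%:E * \int[P]_w (\1_(A i) w * G w)%:E))%E.
  move=> G0 mG.
  have mAG i : measurable_fun setT (fun w => (\1_(A i) w * G w)%:E).
    by apply/measurable_EFinP; exact: measurable_funM.
  have AG0 i w : (0 <= (\1_(A i) w * G w)%:E)%E by rewrite lee_fin mulr_ge0.
  rewrite (eq_integral (fun w => (\sum_(i < #|` fset_set (range (s n))|)
      ((v i)%:E * (\1_(A i) w * G w)%:E))%E)); last first.
    move=> w _; rewrite fE mulr_suml -sumEFin.
    by apply: eq_bigr => i _; rewrite -EFinM mulrA.
  rewrite ge0_integral_sum //.
  - apply: eq_bigr => i _; rewrite ge0_integralZl// ?lee_fin ?v0//.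
  - by move=> i; apply: measurable_funeM.
  - by move=> i w _; rewrite mule_ge0// lee_fin v0.
have s1 : (\int[P]_w (s n (f w))%:E = \int[P]_w (s n (f w) * 1)%:E)%E.
  by apply: eq_integral => w _; rewrite mulr1.
rewrite sE // s1 (sE (fun=> 1)) // ge0_sume_distrl; last first.
  move=> i _; rewrite mule_ge0 ?lee_fin ?v0//.
  by apply: integral_ge0 => w _; rewrite lee_fin mulr1.
apply: eq_bigr => i _; rewrite -muleA AH //; congr (_ * (_ * _))%E.
rewrite -[X in P X]setIT -integral_indic//; last exact: Fm.
by apply: eq_integral => w _; rewrite mulr1.
Qed.

(* Sets are replaced by functions one index at a time: once the indices of [s]
   carry functions, those of [K] still carry sets. *)
Lemma integral_prod_indep_sets (I : finType) (F : I -> set_system Omega)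
    (f : I -> Omega -> R) (s : seq I) (K : {set I}) (A : I -> set Omega) :
  mutually_indep P F -> (forall i, F i `<=` measurable) ->
  (forall i, measurable_wrt (F i) (f i)) -> (forall i w, 0 <= f i w) ->
  (forall i, (\int[P]_w (f i w)%:E < +oo)%E) ->
  uniq s -> {in s, forall i, i \notin K} -> (forall i, i \in K -> F i (A i)) ->
  (\int[P]_w (\1_(\bigcap_(i in [set` K]) A i) w * \prod_(i <- s) f i w)%:E =
   P (\bigcap_(i in [set` K]) A i) * \prod_(i <- s) \int[P]_w (f i w)%:E)%E.
Proof.
move=> indF Fm mf f0 foo.
have mfT i : measurable_fun setT (f i).
  by move=> _ B mB; rewrite setTI; exact/Fm/mf.
have mcap (J : {set I}) (B : I -> set Omega) : (forall i, i \in J -> F i (B i)) ->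
    measurable (\bigcap_(i in [set` J]) B i).
  move=> FB; apply: fin_bigcap_measurable => // i /= iJ; exact/Fm/FB.
elim: s K A => [K A _ _ FA|i s IH K A /= /andP[ins us] sK FA].
  rewrite big_nil mule1 -[X in P X]setIT -integral_indic//; last exact: mcap.
  by apply: eq_integral => w _; rewrite big_nil mulr1.
have iK : i \notin K by apply: sK; rewrite mem_head.
pose H w := \1_(\bigcap_(i in [set` K]) A i) w * \prod_(j <- s) f j w.
have H0 w : 0 <= H w by rewrite mulr_ge0 // prodr_ge0.
have mH : measurable_fun setT H.
  apply: measurable_funM; first by apply: measurable_indic; exact: mcap.
  exact: measurable_prod.
have IHK := IH K A us _ FA.
have {}IHK : (\int[P]_w (H w)%:E =
    P (\bigcap_(i in [set` K]) A i) * \prod_(i <- s) \int[P]_w (f i w)%:E)%E.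
  by apply: IHK => j js; apply: sK; rewrite inE js orbT.
rewrite big_cons muleCA -IHK -(integral_mul_indep (F := F i)) //.
- by apply: eq_integral => w _; rewrite /H big_cons mulrCA.
(* Independence of [f i] and [H], tested on [B] in [F i], is the induction hypothesis for [i |: K],
   where the index [i] now carries the set [B]. *)
- move=> B FB; rewrite IHK.
  pose A' j := if j == i then B else A j.
  have A'E : \bigcap_(j in [set` i |: K]) A' j = B `&` \bigcap_(j in [set` K]) A j.
    apply/seteqP; split => w /=.
      move=> hw; split; first by have := hw i; rewrite /A' /= eqxx; apply; rewrite !inE eqxx.
      move=> j /= jK; have := hw j; rewrite /A' /=.
      have /negbTE -> : j != i by apply: contraNneq iK => <-.
      by apply; rewrite !inE jK orbT.
    move=> [Bw Kw] j /=; rewrite !inE /A'; case: eqP => [_ _ //|_ /= jK].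
    exact: Kw.
  have FA' j : j \in i |: K -> F j (A' j).
    by rewrite !inE /A'; case: eqP => [->//|_ /=]; exact: FA.
  have PA' : (P (B `&` \bigcap_(j in [set` K]) A j) =
      P B * P (\bigcap_(j in [set` K]) A j))%E.
    rewrite -A'E (indF _ _ FA') (indF _ _ FA) (bigD1 i) ?inE ?eqxx//=.
    rewrite /A' eqxx; congr (_ * _)%E; apply: eq_big => [j|j /andP[_ /negbTE ->]//].
    rewrite !inE; case: eqP => [->/=|_]; last by rewrite andbT.
    by rewrite (negbTE iK).
  rewrite muleA -PA' -A'E -(IH (i |: K) A' us _ FA').
    apply: eq_integral => w _; congr EFin; rewrite /H A'E indicI /= mulrA.
    by congr (_ * _).
  move=> j js; rewrite !inE negb_or sK ?inE ?js ?orbT// andbT.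
  by apply: contraNneq ins => <-.
- rewrite IHK ltey_eq; apply/orP; left; apply: fin_numM.
    by apply: fin_num_measure; exact: mcap.
  elim/big_ind : _ => // [x y|j _]; first exact: fin_numM.
  by rewrite ge0_fin_numE// integral_ge0// => w _; rewrite lee_fin.
Qed.

Lemma integral_prod_indep (I : finType) (F : I -> set_system Omega)
    (f : I -> Omega -> R) :
  mutually_indep P F -> (forall i, F i `<=` measurable) ->
  (forall i, measurable_wrt (F i) (f i)) -> (forall i w, 0 <= f i w) ->
  (forall i, (\int[P]_w (f i w)%:E < +oo)%E) ->
  (\int[P]_w (\prod_i f i w)%:E = \prod_i \int[P]_w (f i w)%:E)%E.
Proof.
move=> indF Fm mf f0 foo.
have := @integral_prod_indep_sets I F f (index_enum I) finset.set0 (fun=> setT)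
  indF Fm mf f0 foo (index_enum_uniq I).
have -> : \bigcap_(i in [set` (finset.set0 : {set I})]) [set: Omega] = setT.
  by apply/seteqP; split => // w _ i.
rewrite probability_setT mul1e => <-.
- by apply: eq_integral => w _; rewrite indicT mul1r.
- by move=> i; rewrite inE.
- by move=> i; rewrite inE.
Qed.

End product_expectation.

(** * Covariance inequality for phi-mixing sigma-algebras *)

Section bounded_measurable.
Context (d : measure_display) (Omega : measurableType d) (R : realType).
Context (P : probability Omega R).
Implicit Types (f g : Omega -> R).

(** This class is stable under the operations below and consists of integrable functions, so
    real-valued integrals can be manipulated without separate integrability conditions. *)
Definition bmeasurable f : Prop :=
  measurable_fun setT f /\ exists M : R, forall w, `|f w| <= M.

Lemma bmeasurable_cst c : bmeasurable (fun=> c).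
Proof. by split => //; exists `|c|. Qed.

Lemma bmeasurable_indic (A : set Omega) : measurable A -> bmeasurable \1_A.
Proof.
move=> mA; split; first exact: measurable_indic.
by exists 1 => w; rewrite indicE; case: (_ \in _); rewrite ?normr1 ?normr0.
Qed.

Lemma bmeasurableD f g : bmeasurable f -> bmeasurable g ->
  bmeasurable (fun w => f w + g w).
Proof.
move=> [mf [M fM]] [mg [N gN]]; split; first exact: measurable_funD.
by exists (M + N) => w; rewrite (le_trans (ler_normD _ _))// lerD.
Qed.

Lemma bmeasurableM f g : bmeasurable f -> bmeasurable g ->
  bmeasurable (fun w => f w * g w).
Proof.
move=> [mf [M fM]] [mg [N gN]]; split; first exact: measurable_funM.
by exists (M * N) => w; rewrite normrM ler_pM.
Qed.

Lemma bmeasurableZ c f : bmeasurable f -> bmeasurable (fun w => c * f w).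
Proof. exact/bmeasurableM/bmeasurable_cst. Qed.

Lemma bmeasurableB f g : bmeasurable f -> bmeasurable g ->
  bmeasurable (fun w => f w - g w).
Proof.
move=> bf bg; have := bmeasurableD bf (bmeasurableZ (-1) bg).
by under eq_fun do rewrite mulN1r.
Qed.

Lemma bmeasurable_sum (I : Type) (s : seq I) (f : I -> Omega -> R) :
  (forall i, bmeasurable (f i)) -> bmeasurable (fun w => \sum_(i <- s) f i w).
Proof.
move=> bf; elim: s => [|i s IH].
  under eq_fun do rewrite big_nil; exact: bmeasurable_cst.
under eq_fun do rewrite big_cons; exact: bmeasurableD.
Qed.

Lemma bmeasurable_norm f : bmeasurable f -> bmeasurable (fun w => `|f w|).
Proof.
move=> [mf [M fM]]; split; first exact: measurableT_comp.
by exists M => w; rewrite normr_id.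
Qed.

Lemma bmeasurable_expR f : bmeasurable f -> bmeasurable (fun w => expR (f w)).
Proof.
move=> [mf [M fM]]; split; first exact: measurableT_comp.
exists (expR M) => w; rewrite ger0_norm ?expR_ge0// ler_expR.
exact: le_trans (ler_norm _) (fM w).
Qed.

Lemma bmeasurable_integrable f : bmeasurable f -> P.-integrable setT (EFin \o f).
Proof.
move=> [mf [M fM]]; apply: measurable_bounded_integrable => //.
  by rewrite (le_lt_trans (probability_le1 _ _))// ltry.
exists M; split; first exact: num_real.
by move=> x Mx w _ /=; rewrite (le_trans (fM w))// ltW.
Qed.

Lemma EFin_Rintegral f : bmeasurable f ->
  ((\int[P]_w f w)%:E = \int[P]_w (f w)%:E)%E.
Proof.
by move=> bf; rewrite fineK//; apply: integrable_fin_num (bmeasurable_integrable bf).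
Qed.

Lemma bmeasurable_RintegralD f g : bmeasurable f -> bmeasurable g ->
  \int[P]_w (f w + g w) = \int[P]_w f w + \int[P]_w g w.
Proof. by move=> bf bg; rewrite RintegralD//; exact: bmeasurable_integrable. Qed.

Lemma bmeasurable_RintegralZ c f : bmeasurable f ->
  \int[P]_w (c * f w) = c * \int[P]_w f w.
Proof. by move=> bf; rewrite RintegralZl//; exact: bmeasurable_integrable. Qed.

Lemma bmeasurable_RintegralB f g : bmeasurable f -> bmeasurable g ->
  \int[P]_w (f w - g w) = \int[P]_w f w - \int[P]_w g w.
Proof. by move=> bf bg; rewrite RintegralB//; exact: bmeasurable_integrable. Qed.

Lemma bmeasurable_Rintegral_sum (I : Type) (s : seq I) (f : I -> Omega -> R) :
  (forall i, bmeasurable (f i)) ->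
  \int[P]_w (\sum_(i <- s) f i w) = \sum_(i <- s) \int[P]_w f i w.
Proof.
move=> bf; elim: s => [|i s IH].
  rewrite big_nil -[RHS](mul0r (fine (P setT))) -Rintegral_cst//.
  by apply: eq_Rintegral => w _; rewrite big_nil.
rewrite big_cons -IH -bmeasurable_RintegralD//; last exact: bmeasurable_sum.
by apply: eq_Rintegral => w _; rewrite big_cons.
Qed.

Lemma bmeasurable_le_Rintegral f g : bmeasurable f -> bmeasurable g ->
  (forall w, f w <= g w) -> \int[P]_w f w <= \int[P]_w g w.
Proof.
by move=> bf bg fg; apply: le_Rintegral => // ; exact: bmeasurable_integrable.
Qed.

Lemma bmeasurable_normr_Rintegral f : bmeasurable f ->
  `|\int[P]_w f w| <= \int[P]_w `|f w|.
Proof. by move=> bf; apply: le_normr_Rintegral => //; exact: bmeasurable_integrable. Qed.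

Lemma integral_cst_probability (c : R) : (\int[P]_w c%:E = c%:E)%E.
Proof.
by rewrite integral_cst// -[X in (_ * X)%E]/(P setT) probability_setT mule1.
Qed.

Lemma Rintegral_cst_probability c : \int[P]_w (fun=> c) w = c.
Proof.
rewrite Rintegral_cst// -[X in _ * fine X]/(P setT).
by rewrite probability_setT /= mulr1.
Qed.

Lemma Rintegral_indic (A : set Omega) : measurable A -> \int[P]_w (\1_A w) = fine (P A).
Proof.
by move=> mA; rewrite /Rintegral integral_indic// setIT.
Qed.

End bounded_measurable.

(** The sum counts the positive multiples of [h] below [u]: it is [h] times the integer part of
    [u / h]. *)
Lemma layer_sum_bounds (R : realType) (h u : R) (K : nat) : 0 < h -> 0 <= u <= K%:R * h ->
  let s := \sum_(i < K) h * (i.+1%:R * h <= u)%R%:R in u - h <= s <= u.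
Proof.
move=> h0; elim: K u => [|K IH] u /andP[u0 uK] /=.
  by rewrite big_ord0; move: uK; rewrite mul0r; lra.
rewrite big_ord_recr /=; case: (leP u (K%:R * h)) => uKh.
  have /andP[s1 s2] : u - h <= \sum_(i < K) h * (i.+1%:R * h <= u)%R%:R <= u.
    by apply: IH; rewrite u0 uKh.
  have -> : (K.+1%:R * h <= u) = false.
    by apply/negbTE; rewrite -ltNge (le_lt_trans uKh)// ltr_pM2r// ltr_nat.
  by rewrite mulr0 addr0 s1.
have -> : \sum_(i < K) h * (i.+1%:R * h <= u)%R%:R = K%:R * h.
  rewrite (eq_bigr (fun=> h)) => [|i _].
    by rewrite sumr_const card_ord mulr_natl.
  suff -> : i.+1%:R * h <= u by rewrite mulr1.
  by rewrite (le_trans _ (ltW uKh))// ler_pM2r// ler_nat.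
move: uK; rewrite -natr1; case: (leP _ u) => /= ?; lra.
Qed.

Section layer_cake.
Context (d : measure_display) (Omega : measurableType d) (R : realType).
Context (P : probability Omega R).

(** Replace [U] by a staircase of step [h = M / K]. The bounds on the [K] level sets add up, the
    constants [b] totalling [K * h * b = M * b], and the error, at most [h] times a bound of [G], is
    made smaller than any [e]. It serves twice for the covariance inequality: with [a = 0] to reach
    a bounded [V], with [b = 0] to reach an integrable [U]. *)
Lemma layer_cake (U G : Omega -> R) (M a b : R) :
  bmeasurable G -> measurable_fun setT U -> 0 < M -> (forall w, 0 <= U w <= M) ->
  0 <= a ->
  (forall t, `|\int[P]_w (\1_[set x | t <= U x] w * G w)| <=
             a * fine (P [set x | t <= U x]) + b) ->
  `|\int[P]_w (U w * G w)| <= a * \int[P]_w U w + b * M.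
Proof.
move=> bG mU M0 UM a0 H.
have [g gG] := bG.2.
have bU : bmeasurable U.
  by split=> //; exists M => w; have /andP[? ?] := UM w; rewrite ger0_norm.
apply/ler_addgt0Pr => e e0.
pose K := (Num.truncn (M * `|g| / e)).+1.
have K0 : 0 < K%:R :> R by rewrite ltr0n.
pose h := M / K%:R.
have h0 : 0 < h by rewrite divr_gt0.
have Kh : K%:R * h = M by rewrite /h mulrCA divff ?mulr1// gt_eqF.
have hg : h * `|g| <= e.
  have : M * `|g| / e < K%:R by exact: truncnS_gt.
  by rewrite ltr_pdivrMr// /h mulrAC ler_pdivrMr// mulrC [e * _]mulrC => /ltW; rewrite mulrC.
pose A i := [set x | i.+1%:R * h <= U x].
have mA i : measurable (A i).
  rewrite (_ : A i = U @^-1` `[i.+1%:R * h, +oo[); last first.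
    by apply/seteqP; split => x /=; rewrite in_itv/= andbT.
  by rewrite -[X in measurable X]setTI; exact: mU.
pose S w := \sum_(i < K) h * \1_(A i) w.
have bS : bmeasurable S.
  by apply: bmeasurable_sum => i; apply: bmeasurableZ; exact: bmeasurable_indic.
have SU w : U w - h <= S w <= U w.
  have := @layer_sum_bounds R h (U w) K h0; rewrite Kh => /(_ (UM w)).
  rewrite (_ : \sum_(i < K) _ = S w)//.
  by apply: eq_bigr => i _; rewrite indicE mem_setE.
have bSG : bmeasurable (fun w => S w * G w) by exact: bmeasurableM.
have bD : bmeasurable (fun w => (U w - S w) * G w).
  by apply: bmeasurableM => //; exact: bmeasurableB.
have -> : \int[P]_w (U w * G w) =
    \int[P]_w (S w * G w) + \int[P]_w ((U w - S w) * G w).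
  by rewrite -bmeasurable_RintegralD//; apply: eq_Rintegral => w _; ring.
rewrite (le_trans (ler_normD _ _))// lerD//; last first.
  rewrite (le_trans (bmeasurable_normr_Rintegral _ _))//.
  rewrite (le_trans _ hg)// -[leRHS](Rintegral_cst_probability P).
  apply: bmeasurable_le_Rintegral; first exact: bmeasurable_norm.
    exact: bmeasurable_cst.
  move=> w; rewrite normrM ler_pM//.
    by have /andP[? ?] := SU w; rewrite ger0_norm; lra.
  exact: le_trans (gG w) (ler_norm _).
have -> : \int[P]_w (S w * G w) = \sum_(i < K) h * \int[P]_w (\1_(A i) w * G w).
  have b1 i : bmeasurable (fun w => \1_(A i) w * G w).
    by apply: bmeasurableM => //; exact: bmeasurable_indic.
  under eq_bigr do rewrite -bmeasurable_RintegralZ//.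
  rewrite -bmeasurable_Rintegral_sum; last by move=> i; exact: bmeasurableZ.
  apply: eq_Rintegral => w _; rewrite /S mulr_suml.
  by apply: eq_bigr => i _; rewrite mulrA.
have -> : a * \int[P]_w U w + b * M =
   a * \int[P]_w S w + b * M + a * (\int[P]_w U w - \int[P]_w S w) by ring.
rewrite -[leLHS]addr0 lerD//; last first.
  rewrite mulr_ge0// subr_ge0; apply: bmeasurable_le_Rintegral => // w.
  by have /andP[] := SU w.
rewrite (le_trans (ler_norm_sum _ _ _))//.
have -> : a * \int[P]_w S w + b * M = \sum_(i < K) h * (a * fine (P (A i)) + b).
  under eq_bigr do rewrite mulrDr; rewrite big_split/= sumr_const card_ord.
  rewrite -mulr_natl -Kh mulrCA mulrA; congr (_ + _); last by ring.
  rewrite /S bmeasurable_Rintegral_sum; last first.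
    by move=> i; apply: bmeasurableZ; exact: bmeasurable_indic.
  rewrite mulr_sumr; apply: eq_bigr => i _.
  rewrite bmeasurable_RintegralZ ?Rintegral_indic//; last exact: bmeasurable_indic.
  by ring.
by apply: ler_sum => i _; rewrite normrM gtr0_norm// ler_pM2l//; exact: H.
Qed.

End layer_cake.

Section phi_mixing_covariance.
Context (d : measure_display) (Omega : measurableType d) (R : realType).
Context (P : probability Omega R).
Context (FA FB : set_system Omega).
Hypotheses (mFA : FA `<=` measurable) (mFB : FB `<=` measurable).

Let fineP_ge0 (A : set Omega) : 0 <= fine (P A).
Proof. exact: fine_ge0. Qed.

Let phi_set_ub : ubound [set x : R | exists A B : set Omega,
    [/\ FA A, FB B, P A != 0%E &
    x = `|fine (P B) - fine (P (A `&` B)) / fine (P A)|]] 1.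
Proof.
move=> x [A [B [FAA FBB PA0 ->]]].
have pA : 0 < fine (P A).
  rewrite fine_gt0// lt0e PA0 measure_ge0/=.
  by rewrite (le_lt_trans (probability_le1 _ (mFA FAA)))// ltry.
have PB1 : fine (P B) <= 1.
  by rewrite -lee_fin fineK ?probability_le1 ?fin_num_measure//; exact: mFB.
have PAB : fine (P (A `&` B)) <= fine (P A).
  have mA := mFA FAA; have mB := mFB FBB.
  apply: fine_le; rewrite ?fin_num_measure//; try exact: measurableI.
  by apply: le_measure; [apply/mem_set; exact: measurableI|exact/mem_set|exact: subIsetl].
have : 0 <= fine (P (A `&` B)) / fine (P A) <= 1.
  by rewrite divr_ge0//= ler_pdivrMr// mul1r.
have := fineP_ge0 B.
by move: (fine _ / _) => y ? ?; rewrite ler_norml; lra.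
Qed.

Lemma phi_coef_ge0 : 0 <= phi_coef P FA FB.
Proof.
rewrite /phi_coef; set D := [set x | _].
have [->|/set0P[x Dx]] := eqVneq D set0; first by rewrite sup0.
have : x <= sup D by apply: ub_le_sup => //; exists 1; exact: phi_set_ub.
by apply: le_trans; case: Dx => [A [B [_ _ _ ->]]].
Qed.

Lemma phi_coef_le1 : phi_coef P FA FB <= 1.
Proof.
rewrite /phi_coef; set D := [set x | _].
have [->|/set0P D0] := eqVneq D set0; first by rewrite sup0.
by apply: sup_le_ub => //; exact: phi_set_ub.
Qed.

(** Multiplying by [P A] extends the bound to null sets [A], which the definition of the coefficient
    leaves out and which the level sets of a function may well be. *)
Lemma phi_coef_le A B : FA A -> FB B ->
  `|fine (P (A `&` B)) - fine (P A) * fine (P B)| <= phi_coef P FA FB * fine (P A).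
Proof.
move=> FAA FBB; have mA := mFA FAA; have mB := mFB FBB.
have [PA0|PA0] := eqVneq (P A) 0%E.
  have -> : P (A `&` B) = 0%E.
    apply/eqP; rewrite eq_le measure_ge0 andbT -PA0.
    by apply: le_measure; [apply/mem_set; exact: measurableI|exact/mem_set|exact: subIsetl].
  by rewrite PA0 /= mul0r mulr0 subrr normr0.
have pA : 0 < fine (P A).
  rewrite fine_gt0// lt0e PA0 measure_ge0/=.
  by rewrite (le_lt_trans (probability_le1 _ mA))// ltry.
have : `|fine (P B) - fine (P (A `&` B)) / fine (P A)| <= phi_coef P FA FB.
  by apply: ub_le_sup; [exists 1; exact: phi_set_ub|exists A, B].
rewrite -(ler_pM2r pA) -{2}(gtr0_norm pA) -normrM mulrBl divfK ?gt_eqF// distrC.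
by rewrite [fine (P B) * _]mulrC.
Qed.

(** Pass from events to functions by two layer cakes: over the levels of [V + m], whose range has
    length [2 * m], for a fixed event of [FA]; then over the levels of the positive and negative
    parts of [U]. Keeping the first absolute moment of [U] on the right, instead of a supremum, is
    what allows [U] to be an increment of exponentials. *)
Lemma phi_covariance (U V : Omega -> R) (m : R) : 0 < m ->
  measurable_wrt FA U -> (exists M, forall w, `|U w| <= M) ->
  measurable_wrt FB V -> (forall w, `|V w| <= m) -> \int[P]_w V w = 0 ->
  `|\int[P]_w (U w * V w)| <= 2 * m * phi_coef P FA FB * \int[P]_w `|U w|.
Proof.
move=> m0 mU [M UM] mV Vm EV.
have bV : bmeasurable V.
  by split; [move=> _ B mB; rewrite setTI; exact/mFB/mV | exists m].
have ph0 := phi_coef_ge0.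
have stepA A : FA A ->
    `|\int[P]_w (\1_A w * V w)| <= 2 * m * phi_coef P FA FB * fine (P A).
  move=> FAA; have mA := mFA FAA.
  have bA := bmeasurable_indic R mA.
  have bVm : bmeasurable (fun w => V w + m).
    by apply: bmeasurableD => //; exact: bmeasurable_cst.
  have bG : bmeasurable (fun w => \1_A w - fine (P A)).
    by apply: bmeasurableB => //; exact: bmeasurable_cst.
  (* Shifting [V] by [m] changes nothing because the indicator is centred, and centring the
     indicator changes nothing because [V] has mean zero. *)
  have E1 : \int[P]_w ((V w + m) * (\1_A w - fine (P A))) =
      \int[P]_w (\1_A w * V w).
    rewrite (@eq_Rintegral _ _ _ P setT (fun w => (\1_A w * V w + m * \1_A w) -
        fine (P A) * (V w + m))); last by move=> w _; ring.
    have b1 : bmeasurable (fun w => \1_A w * V w) by exact: bmeasurableM.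
    have b2 : bmeasurable (fun w => m * \1_A w) by exact: bmeasurableZ.
    rewrite bmeasurable_RintegralB//; [|exact: bmeasurableD|exact: bmeasurableZ].
    rewrite bmeasurable_RintegralD// !bmeasurable_RintegralZ//.
    rewrite bmeasurable_RintegralD//; last exact: bmeasurable_cst.
    by rewrite EV Rintegral_indic// Rintegral_cst_probability; ring.
  have := @layer_cake _ _ _ P (fun w => V w + m) (fun w => \1_A w - fine (P A))
    (2 * m) 0 (phi_coef P FA FB * fine (P A)) bG bVm.1 _ _ (lexx 0) _.
  rewrite mul0r add0r E1.
  rewrite (_ : _ * (2 * m) = 2 * m * phi_coef P FA FB * fine (P A)); last by ring.
  apply.
  - by lra.
  - by move=> w; have := Vm w; rewrite ler_norml; lra.
  - move=> t; pose B := [set x | t <= V x + m].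
    have BE : B = V @^-1` `[t - m, +oo[.
      by rewrite /B; apply/seteqP; split => x /=; rewrite in_itv/= andbT => ?; lra.
    have FBB : FB B by rewrite BE; exact: mV.
    have mB := mFB FBB.
    rewrite mul0r add0r -/B (@eq_Rintegral _ _ _ P setT (fun w => \1_(A `&` B) w -
      fine (P A) * \1_B w)); last by move=> w _; rewrite indicI /=; ring.
    rewrite bmeasurable_RintegralB; last 2 first.
    + by apply: bmeasurable_indic; exact: measurableI.
    + by apply: bmeasurableZ; exact: bmeasurable_indic.
    rewrite bmeasurable_RintegralZ; last exact: bmeasurable_indic.
    rewrite !Rintegral_indic//; first exact: phi_coef_le.
    exact: measurableI.
(* The added 1 makes the upper bound strictly positive, as [layer_cake] requires. *)
have stepB (W : Omega -> R) : measurable_wrt FA W -> (forall w, 0 <= W w <= `|M| + 1) ->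
    `|\int[P]_w (W w * V w)| <= 2 * m * phi_coef P FA FB * \int[P]_w W w.
  move=> mW WM; rewrite -[leRHS]addr0 -(mul0r (`|M| + 1)).
  apply: layer_cake => //.
  - by move=> _ B mB; rewrite setTI; exact/mFA/mW.
  - by rewrite mulr_ge0// mulr_ge0// ltW.
  - move=> t; rewrite addr0; apply: stepA.
    rewrite (_ : [set x | _] = W @^-1` `[t, +oo[); first exact: mW.
    by apply/seteqP; split => x /=; rewrite in_itv/= andbT.
have bU : bmeasurable U.
  by split; [move=> _ B mB; rewrite setTI; exact/mFA/mU | exists M].
have mUg (g : R -> R) : measurable_fun [set: R] g -> measurable_wrt FA (g \o U).
  move=> mg B mB; rewrite comp_preimage; apply: mU.
  by rewrite -[X in measurable X]setTI; exact: mg.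
pose Up w := Num.max (U w) 0; pose Un w := Num.max (- U w) 0.
have UE w : U w = Up w - Un w by rewrite /Up /Un; case: (leP (U w) 0) ; case: (leP (- U w) 0); lra.
have UA w : `|U w| = Up w + Un w.
  by rewrite /Up /Un; case: (ler0P (U w)) ; case: (leP (- U w) 0); lra.
have mUp : measurable_wrt FA Up.
  by apply: (mUg (fun x => Num.max x 0)); exact: measurable_maxr.
have mUn : measurable_wrt FA Un.
  by apply: (mUg (fun x => Num.max (- x) 0)); apply: measurable_maxr.
have UpM w : 0 <= Up w <= `|M| + 1.
  rewrite le_max lexx orbT/= ge_max; have := UM w; have := ler_norm M.
  by rewrite ler_norml; lra.
have UnM w : 0 <= Un w <= `|M| + 1.
  rewrite le_max lexx orbT/= ge_max; have := UM w; have := ler_norm M.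
  by rewrite ler_norml; lra.
have bp (W : Omega -> R) : measurable_wrt FA W -> (forall w, 0 <= W w <= `|M| + 1) -> bmeasurable W.
  move=> mW WM; split; first by move=> _ B mB; rewrite setTI; exact/mFA/mW.
  by exists (`|M| + 1) => w; have /andP[? ?] := WM w; rewrite ger0_norm.
have bUp := bp _ mUp UpM; have bUn := bp _ mUn UnM.
rewrite (@eq_Rintegral _ _ _ P setT (fun w => Up w * V w - Un w * V w)); last first.
  by move=> w _; rewrite UE mulrBl.
rewrite [X in _ <= _ * X](@eq_Rintegral _ _ _ P setT (fun w => Up w + Un w)); last by move=> w _.
rewrite bmeasurable_RintegralB; [|exact: bmeasurableM|exact: bmeasurableM].
rewrite bmeasurable_RintegralD// mulrDr (le_trans (ler_normB _ _))// lerD//.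
  exact: stepB.
exact: stepB.
Qed.

End phi_mixing_covariance.

(** * Exponential moment of a weighted sum of phi-mixing variables *)

Section exponential_inequalities.
Context (R : realType).
Implicit Types x y : R.

(* [expR (x / 2) <= (1 - x / 2)^-1], squared. *)
Lemma expR_le_quadratic x : x <= 1 -> expR x <= 1 + x + 2 * x ^+ 2.
Proof.
move=> x1.
have h1 : 0 < 1 - x / 2 by lra.
have h2 : 1 - x / 2 <= expR (- (x / 2)).
  by rewrite (le_trans _ (expR_ge1Dx _)).
have h3 : expR (x / 2) <= (1 - x / 2)^-1.
  by rewrite -[expR (x / 2)]invrK -expRN lef_pV2 ?posrE ?expR_gt0.
have -> : expR x = expR (x / 2) ^+ 2.
  by rewrite expr2 -expRD -splitr.
apply: (@le_trans _ _ ((1 - x / 2)^-1 ^+ 2)).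
  by rewrite lerXn2r ?nnegrE ?expR_ge0// invr_ge0 ltW.
rewrite exprVn -[leLHS]mul1r ler_pdivrMr ?exprn_gt0//.
have -> : (1 + x + 2 * x ^+ 2) * (1 - x / 2) ^+ 2 =
   1 + x ^+ 2 * ((1 - x) * (5 / 2 - x)) / 2 by field.
by rewrite lerDl divr_ge0// mulr_ge0 ?sqr_ge0// mulr_ge0//; lra.
Qed.

(** The linear term stays apart because its integral against the past is small by mixing; the
    remainder is a pure exponential, so that the bounds multiply along the induction. *)
Lemma expR_le_addr_expR_sqr x : expR x <= x + expR (2 * x ^+ 2).
Proof.
have [x1|x1] := leP x 1.
  rewrite (le_trans (expR_le_quadratic x1))//.
  have := expR_ge1Dx (2 * x ^+ 2); lra.
rewrite (@le_trans _ _ (expR (2 * x ^+ 2)))//; last by rewrite lerDr; lra.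
by rewrite ler_expR expr2; nra.
Qed.

Lemma expR_lipschitz x y : `|expR x - expR y| <= `|x - y| * (expR x + expR y).
Proof.
wlog xy : x y / y <= x.
  move=> H; have [|/ltW] := leP y x; first exact: H.
  by move=> /H; rewrite distrC (distrC y) (addrC (expR y)).
rewrite !ger0_norm ?subr_ge0 ?ler_expR//.
have := expR_ge1Dx (y - x); rewrite expRD expRN => h.
have : (1 + (y - x)) * expR x <= expR y.
  by rewrite -ler_pdivlMr ?expR_gt0.
have := expR_gt0 x; have := expR_gt0 y; nra.
Qed.

Lemma addr_le_expR_mul x y : 0 <= x -> 0 <= y -> expR x + y <= expR (x + y).
Proof.
move=> x0 y0; rewrite expRD.
have := expR_ge1Dx y; have := expR_ge1Dx x; nra.
Qed.

End exponential_inequalities.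

Section sigma_gen.
Context (I : Type) (d dV : measure_display) (Omega : measurableType d).
Context (V : measurableType dV) (Z : I -> Omega -> V).

Lemma sigma_gen_measurable (D : set I) : (forall i, measurable_fun setT (Z i)) ->
  sigma_gen D Z `<=` measurable.
Proof.
move=> mZ; apply: smallest_sub; first exact: sigma_algebra_measurable.
move=> A [i Di [B mB <-]]; exact: mZ.
Qed.

Lemma measurable_wrt_sigma_gen (D : set I) i : D i ->
  measurable_wrt (sigma_gen D Z) (Z i).
Proof.
move=> Di B mB; apply: sub_gen_smallest; exists i => //; exists B => //.
by rewrite setTI.
Qed.

(** Viewing [<<s G>>] as the sigma-algebra of a type makes the stability lemmas for [measurable_fun]
    (sums, products, compositions) available for the past and the future of the process. *)
Lemma measurable_wrt_gP (G : set_system Omega) dW (W : measurableType dW) (f : Omega -> W) :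
  measurable_wrt <<s G>> f <->
  measurable_fun (setT : set (g_sigma_algebraType G)) f.
Proof.
split=> [mf _ B mB|mf B mB]; first by rewrite setTI; exact: mf.
by have := mf measurableT B mB; rewrite setTI.
Qed.

End sigma_gen.

Section mixing_exponential_moment.
Context (d : measure_display) (Omega : measurableType d) (R : realType).
Context (P : probability Omega R) (Z : int -> {RV P >-> R}).

Local Notation past t := (sigma_gen [set h : int | h <= t] Z).
Local Notation future t := (sigma_gen [set l : int | t <= l] Z).

Let mZ i : measurable_fun setT (Z i).
Proof. exact: measurable_funP. Qed.

Let mpast t : past t `<=` measurable.
Proof. exact: sigma_gen_measurable. Qed.

Let mfuture t : future t `<=` measurable.
Proof. exact: sigma_gen_measurable. Qed.

Lemma phi_coef_le_mixing (t : int) (i : nat) :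
  phi_coef P (past t) (future (t + i%:Z)) <= phi_mixing P Z i.
Proof.
apply: ub_le_sup; last by exists t.
by exists 1 => x [s _ <-]; exact: phi_coef_le1.
Qed.

Lemma phi_mixing_ge0 i : 0 <= phi_mixing P Z i.
Proof. by apply: le_trans (phi_coef_le_mixing 0 i); exact: phi_coef_ge0. Qed.

Lemma phi_mixing_le1 i : phi_mixing P Z i <= 1.
Proof.
apply: sup_le_ub; first by exists (phi_coef P (past 0) (future (0 + i%:Z))), 0.
by move=> x [s _ <-]; exact: phi_coef_le1.
Qed.

Context (g : R -> R) (m : R) (c : nat -> R).
Hypotheses (mg : measurable_fun [set: R] g) (m0 : 0 < m).
Hypothesis gm : forall x, `|g x| <= m.

Local Notation V k := (fun w => g (Z k%:Z w)).
Let S k w := \sum_(l < k) c l * V l.+1 w.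

Let mV k : measurable_fun setT (V k).
Proof. exact: measurableT_comp. Qed.

Let bV k : bmeasurable (V k).
Proof. by split => //; exists m. Qed.

Let bS k : bmeasurable (S k).
Proof. by apply: bmeasurable_sum => l; exact: bmeasurableZ. Qed.

Let pastS l k : (l <= k)%N -> measurable_wrt (past k%:Z) (fun w => expR (S l w)).
Proof.
move=> lk.
apply/measurable_wrt_gP; apply: measurableT_comp => //.
apply: measurable_sum => j; apply: measurable_funM => //.
apply: measurableT_comp => //; apply/measurable_wrt_gP.
apply: measurable_wrt_sigma_gen => /=; have := ltn_ord j; lia.
Qed.

(** Exponent accumulated by the induction, up to the factor [m ^+ 2]. At index [i], the term
    [2 * c i ^+ 2] is the second-order remainder of the exponential, and the inner sum collects the
    covariances with earlier increments; its factor 4 is the 2 of the covariance inequality times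
    the two exponentials of [expR_lipschitz]. *)
Let expo k : R := \sum_(i < k) (2 * c i ^+ 2 +
  4 * `|c i| * \sum_(l < i) phi_mixing P Z (i - l) * `|c l|).

Let expo_le k l : (l <= k)%N -> expo l <= expo k.
Proof.
move: l k; apply/nondecreasing_seqP => k; rewrite /expo big_ord_recr/= lerDl.
apply: addr_ge0; first by rewrite mulr_ge0 ?sqr_ge0.
rewrite mulr_ge0 ?mulr_ge0// sumr_ge0// => j _.
by rewrite mulr_ge0// phi_mixing_ge0.
Qed.

(* [expR (S k)] is written as a telescoping sum over [l < k], whose increments
   depend on the variables up to time [l.+1] and are thus almost uncorrelated
   with [V k.+1]. *)
Lemma mixing_exponential_moment_aux k :
  (forall l, (l < k)%N -> \int[P]_w V l.+1 w = 0) ->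
  \int[P]_w expR (S k w) <= expR (m ^+ 2 * expo k).
Proof.
elim/ltn_ind: k => -[_ _|k IH EV].
  rewrite /expo big_ord0 mulr0 expR0 -[leRHS](Rintegral_cst_probability P).
  apply: bmeasurable_le_Rintegral; first exact: bmeasurable_expR.
    exact: bmeasurable_cst.
  by move=> w; rewrite /S big_ord0 expR0.
(* The covariance with the increment [D l] involves the moments at [l] and [l.+1]; strong induction
   and monotonicity of [expo] bound all of them by the same [b]. *)
have IHl l : (l <= k)%N -> \int[P]_w expR (S l w) <= expR (m ^+ 2 * expo k).
  move=> lk; apply: (@le_trans _ _ (expR (m ^+ 2 * expo l))).
    by apply: IH => // j jl; apply: EV; lia.
  by rewrite ler_expR ler_wpM2l ?sqr_ge0// expo_le.
set b := expR (m ^+ 2 * expo k) in IHl *.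
have b0 : 0 < b by exact: expR_gt0.
have bE l : bmeasurable (fun w => expR (S l w)) by exact: bmeasurable_expR.
have SS l w : S l.+1 w = S l w + c l * V l.+1 w by rewrite /S big_ord_recr.
pose D l w := expR (S l.+1 w) - expR (S l w).
have bD l : bmeasurable (D l) by exact: bmeasurableB.
have DE w : expR (S k w) = 1 + \sum_(l < k) D l w.
  rewrite -(big_mkord xpredT (D^~ w)) /D.
  have S0 : S 0 w = 0 by rewrite /S big_ord0.
  by rewrite (telescope_sumr (fun l => expR (S l w)))// S0 expR0 addrC subrK.
have cov l : (l < k)%N -> `|\int[P]_w (D l w * V k.+1 w)| <=
    4 * m ^+ 2 * (phi_mixing P Z (k - l) * `|c l|) * b.
  move=> lk.
  have mD : measurable_wrt (past l.+1%:Z) (D l).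
    apply/measurable_wrt_gP; apply: measurable_funB.
      by apply/measurable_wrt_gP; exact: pastS.
    by apply/measurable_wrt_gP; exact: pastS.
  (* Times start at 1: [D l] reaches up to time [l + 1] and [V k.+1] sits at time [k + 1], hence a
     gap of [k - l]. *)
  have mV' : measurable_wrt (future (l.+1%:Z + (k - l)%:Z)) (V k.+1).
    apply/measurable_wrt_gP; apply: measurableT_comp => //; apply/measurable_wrt_gP.
    by apply: measurable_wrt_sigma_gen => /=; lia.
  apply: le_trans (phi_covariance (@mpast _) (@mfuture _) m0 mD (bD l).2 mV' _ _) _ => //.
    exact: EV.
  have absD : \int[P]_w `|D l w| <= `|c l| * m * (2 * b).
    apply: (@le_trans _ _ (\int[P]_w (`|c l| * m * (expR (S l.+1 w) + expR (S l w))))).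
      apply: bmeasurable_le_Rintegral => [||w]; first exact: bmeasurable_norm.
        by apply: bmeasurableZ; exact: bmeasurableD.
      rewrite (le_trans (expR_lipschitz _ _))// ler_wpM2r ?addr_ge0 ?expR_ge0//.
      by rewrite SS addrAC subrr add0r normrM ler_wpM2l.
    rewrite bmeasurable_RintegralZ; last exact: bmeasurableD.
    rewrite bmeasurable_RintegralD// ler_wpM2l ?mulr_ge0 ?(ltW m0)//.
    by have := IHl _ lk; have := IHl _ (ltnW lk); lra.
  have -> : 4 * m ^+ 2 * (phi_mixing P Z (k - l) * `|c l|) * b =
      2 * m * phi_mixing P Z (k - l) * (`|c l| * m * (2 * b)) by ring.
  apply: ler_pM => //.
  - by rewrite !mulr_ge0 ?phi_coef_ge0// ltW.
  - exact: Rintegral_ge0.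
  - by rewrite ler_pM2l ?phi_coef_le_mixing// mulr_gt0.
have Vk : `|\int[P]_w (V k.+1 w * expR (S k w))| <=
    4 * m ^+ 2 * (\sum_(l < k) phi_mixing P Z (k - l) * `|c l|) * b.
  have -> : \int[P]_w (V k.+1 w * expR (S k w)) =
      \int[P]_w (V k.+1 w + \sum_(l < k) D l w * V k.+1 w).
    by apply: eq_Rintegral => w _; rewrite DE mulrDr mulr1 mulrC mulr_suml.
  have bDV l : bmeasurable (fun w => D l w * V k.+1 w) by exact: bmeasurableM.
  rewrite bmeasurable_RintegralD//; last exact: bmeasurable_sum.
  rewrite EV// add0r bmeasurable_Rintegral_sum// mulr_sumr mulr_suml.
  by rewrite (le_trans (ler_norm_sum _ _ _))// ler_sum// => l _; exact: cov.
set s := \sum_(l < k) _ in Vk.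
have s0 : 0 <= s by apply: sumr_ge0 => l _; rewrite mulr_ge0 ?phi_mixing_ge0.
have bVE : bmeasurable (fun w => V k.+1 w * expR (S k w)) by exact: bmeasurableM.
set q := expR (2 * (m ^+ 2 * c k ^+ 2)).
apply: (@le_trans _ _ (\int[P]_w (c k * (V k.+1 w * expR (S k w)) + q * expR (S k w)))).
  apply: bmeasurable_le_Rintegral => // [|w].
    by apply: bmeasurableD; exact: bmeasurableZ.
  rewrite SS expRD mulrC mulrA -mulrDl ler_wpM2r ?expR_ge0//.
  rewrite (le_trans (expR_le_addr_expR_sqr _))// lerD2l ler_expR ler_wpM2l//.
  rewrite exprMn mulrC ler_wpM2r ?sqr_ge0// -real_normK ?num_real//.
  by rewrite lerXn2r ?nnegrE// ltW.
rewrite bmeasurable_RintegralD; [|exact: bmeasurableZ|exact: bmeasurableZ].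
rewrite !bmeasurable_RintegralZ//.
have h1 : c k * \int[P]_w (V k.+1 w * expR (S k w)) <= `|c k| * (4 * m ^+ 2 * s * b).
  by rewrite (le_trans (ler_norm _))// normrM ler_wpM2l.
have h2 : q * \int[P]_w expR (S k w) <= q * b.
  by rewrite ler_wpM2l ?expR_ge0//; exact: IHl.
apply: (@le_trans _ _ ((q + 4 * m ^+ 2 * `|c k| * s) * b)).
  by rewrite mulrDl; lra.
rewrite [expo k.+1]/expo big_ord_recr/= -/(expo k) mulrDr expRD -/b mulrC ler_wpM2l ?(ltW b0)//.
rewrite /q (le_trans (addr_le_expR_mul _ _))//.
- by rewrite mulr_ge0// mulr_ge0 ?sqr_ge0.
- by rewrite mulr_ge0// mulr_ge0// mulr_ge0 ?sqr_ge0.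
- by rewrite ler_expR -/s; lra.
Qed.

(** A Schur test: [2 |c_i| |c_l| <= c_i^2 + c_l^2] reduces the double sum to the rows and the
    columns of the triangular array [phi (i - l)], each of sum at most [q]. As the coefficients lie
    in [[0, 1]], they are below their square roots, so [1 + q] is at most the mixing sum and
    [2 + 4 q] at most four times its square. *)
Lemma mixing_exponential_moment T :
  (forall l, (l < T)%N -> \int[P]_w V l.+1 w = 0) ->
  \int[P]_w expR (\sum_(l < T) c l * V l.+1 w) <=
  expR (4 * m ^+ 2 * mixing_sum P Z T ^+ 2 * \sum_(l < T) c l ^+ 2).
Proof.
move=> EV; apply: le_trans (mixing_exponential_moment_aux EV) _.
set phi := phi_mixing P Z; set s := \sum_(l < T) _.
have phi0 i : 0 <= phi i by exact: phi_mixing_ge0.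
pose q := \sum_(1 <= i < T.+1) phi i.
have q0 : 0 <= q by apply: sumr_ge0.
have tail k : (k <= T)%N -> \sum_(1 <= i < k.+1) phi i <= q.
  by move=> kT; rewrite /q (@big_cat_nat _ _ _ k.+1 1 T.+1)//= lerDl sumr_ge0.
have rows i : (i < T)%N -> \sum_(l < i) phi (i - l)%N <= q.
  move=> iT; apply: le_trans (tail i (ltnW iT)).
  rewrite -(big_mkord xpredT (fun l => phi (i - l)%N)) big_nat_rev/= add0n.
  rewrite big_add1/= big_nat [leRHS]big_nat; apply: ler_sum => l /andP[_ li].
  by rewrite subKn.
have cols l : (l < T)%N -> \sum_(i < T | (l < i)%N) phi (i - l)%N <= q.
  move=> lT; rewrite -(big_mkord (fun i => (l < i)%N) (fun i => phi (i - l)%N)).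
  rewrite (@big_cat_nat _ _ _ l.+1 0 T)//=.
  rewrite big_nat_cond big1 ?add0r; last by move=> i; lia.
  rewrite (_ : \sum_(_ <= i < _ | _) _ = \sum_(l.+1 <= i < T) phi (i - l)%N); last first.
    rewrite big_nat_cond [RHS]big_nat_cond; apply: eq_bigl => i; lia.
  rewrite -[l.+1]add1n big_addn.
  under eq_bigr do rewrite addnK.
  rewrite (_ : (T - l = (T - l).-1.+1)%N); last lia.
  by apply: tail; lia.
have s0 : 0 <= s by apply: sumr_ge0 => l _; exact: sqr_ge0.
have qPhi : 1 + q <= mixing_sum P Z T.
  rewrite /mixing_sum lerD2l; apply: ler_sum => i _.
  have := phi_mixing_le1 i; have := phi0 i; rewrite -/phi -/(phi i) => p0 p1.
  rewrite -[leLHS]ger0_norm// -sqrtr_sqr ler_wsqrtr// expr2.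
  by rewrite -[leRHS]mul1r ler_wpM2r.
have expoE : expo T <= (2 + 4 * q) * s.
  apply: (@le_trans _ _ (\sum_(i < T) (2 * c i ^+ 2 +
      \sum_(l < T | (l < i)%N) (2 * (phi (i - l)%N * c i ^+ 2) +
                                2 * (phi (i - l)%N * c l ^+ 2))))).
    rewrite /expo; apply: ler_sum => i _; rewrite lerD2l mulr_sumr.
    rewrite (big_ord_widen_cond T xpredT
      (fun l => 4 * `|c i| * (phi (i - l)%N * `|c l|)))//; last exact: ltnW.
    apply: ler_sum => l li.
    have := phi0 (i - l)%N; rewrite -(real_normK (num_real (c i))) -(real_normK (num_real (c l))).
    have : 0 <= (`|c i| - `|c l|) ^+ 2 by exact: sqr_ge0.
    rewrite -/phi; move: (phi _) (`|c i|) (`|c l|) => p x y; rewrite !expr2; nra.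
  rewrite big_split/= mulrDl lerD//; first by rewrite -mulr_sumr.
  under eq_bigr do rewrite big_split/= -!mulr_sumr -mulr_suml.
  rewrite big_split/= -!mulr_sumr.
  have h1 : \sum_(i < T) (\sum_(l < T | (l < i)%N) phi (i - l)%N) * c i ^+ 2 <= q * s.
    rewrite mulr_sumr; apply: ler_sum => i _; rewrite ler_wpM2r ?sqr_ge0//.
    rewrite -(big_ord_widen_cond T xpredT (fun l => phi (i - l)%N)); last exact: ltnW.
    exact: rows.
  have h2 : \sum_(i < T) \sum_(l < T | (l < i)%N) phi (i - l)%N * c l ^+ 2 <= q * s.
    rewrite (exchange_big_dep xpredT)//= mulr_sumr; apply: ler_sum => l _.
    by rewrite -mulr_suml ler_wpM2r ?sqr_ge0//; exact: cols.
  lra.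
rewrite ler_expR (_ : 4 * m ^+ 2 * _ * _ = m ^+ 2 * (4 * mixing_sum P Z T ^+ 2 * s)); last by ring.
rewrite ler_wpM2l ?sqr_ge0// (le_trans expoE)// ler_wpM2r//.
have : 1 + q <= mixing_sum P Z T ^+ 2 by rewrite expr2; nra.
by lra.
Qed.

End mixing_exponential_moment.

(** * Exponential moment under Bernstein's moment conditions *)

Section bernstein_moment.
Context (d : measure_display) (Omega : measurableType d) (R : realType).
Context (P : probability Omega R) (xi : {RV P >-> R}) (c v : R).
Hypotheses (c0 : 0 < c) (v0 : 0 < v).
Hypothesis xi_mean : ('E_P[xi] = 0)%E.
Hypothesis xi2 : ('E_P[fun w => (xi w ^+ 2)%R] <= v%:E)%E.
Hypothesis xiq : forall q : nat, (3 <= q)%N ->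
  ('E_P[fun w => (`|xi w| ^+ q)%R] <= (v * c ^+ (q - 2) * (q`!)%:R / 2)%:E)%E.

Let mxi : measurable_fun setT xi.
Proof. exact: measurable_funP. Qed.

(** The linear term keeps its sign, since it must vanish on average; absolute values from order two
    on give a nonnegative series, which can be integrated term by term. *)
Lemma expR_le_nneseries (y : R) :
  ((expR y)%:E <= (1 + y)%:E + \sum_(q <oo) (`|y| ^+ q.+2 / q.+2`!%:R)%:E)%E.
Proof.
have cvge : (series (exp_coeff y) n)%:E @[n --> \oo] --> (expR y)%:E.
  apply: cvg_EFin; first by near=> n.
  exact: is_cvg_series_exp_coeff.
apply: cvge_le cvge; exists 2%N => // -[|[|n]] //= _.
rewrite /series/= 2?big_nat_recl//=.
rewrite {1 2}/exp_coeff/= expr0 expr1 !divr1 addrA EFinD leeD2l//.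
apply: le_trans (nneseries_lim_ge n _); last by move=> q _ _; rewrite lee_fin.
rewrite sumEFin lee_fin; apply: ler_sum => q _.
by rewrite (le_trans (ler_norm _))// /exp_coeff/= normrM normfV normrX normr_nat.
Unshelve. all: by end_near. Qed.

(** The factorials cancel: the term of order [q + 2] is at most [s^2 v / 2 * (|s| c)^q], and for
    [|s| c <= 1 / 2] the geometric series sums to at most twice its first term. *)
Lemma bernstein_expR_moment (s : R) : `|s| * c <= 1 / 2 ->
  (\int[P]_w (expR (s * xi w))%:E <= (1 + s ^+ 2 * v)%:E)%E.
Proof.
move=> sc.
pose h w : \bar R := (\sum_(q <oo) (`|s * xi w| ^+ q.+2 / q.+2`!%:R)%:E)%E.
have h0 w : (0 <= h w)%E by apply: nneseries_ge0 => n _ _; rewrite lee_fin.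
have mhq q : measurable_fun setT (fun w => (`|s * xi w| ^+ q.+2 / q.+2`!%:R)%:E).
  apply/measurable_EFinP; apply: measurable_funM => //.
  apply: measurable_funX; apply: measurableT_comp => //; exact: measurable_funM.
have mh : measurable_fun setT h.
  by apply: ge0_emeasurable_sum => // q w _ _; rewrite lee_fin.
have moment q : (\int[P]_w (`|xi w| ^+ q.+2)%:E <= (v * c ^+ q * (q.+2`!)%:R / 2)%:E)%E.
  case: q => [|q].
    have := xi2; rewrite unlock expr0 mulr1 -mulrA mulfV// mulr1.
    by under eq_integral do rewrite -[X in X%:E]real_normK ?num_real//.
  have := xiq (q := q.+3) isT; rewrite unlock /= !subSS subn0; exact.
have ih : (\int[P]_w h w <= (s ^+ 2 * v)%:E)%E.
  rewrite /h integral_nneseries//.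
  apply: lime_le.
    by apply: is_cvg_nneseries => q _ _; apply: integral_ge0 => w _; rewrite lee_fin.
  apply: nearW => n.
  apply: (@le_trans _ _ (\sum_(0 <= q < n) (s ^+ 2 * v / 2 * (1 / 2) ^+ q)%:E)%E).
    apply: lee_sum => q _.
    rewrite (_ : (fun w => _) =
      (fun w => (`|s| ^+ q.+2 / q.+2`!%:R)%:E * (`|xi w| ^+ q.+2)%:E)%E); last first.
      by apply/funext => w; rewrite -EFinM normrM exprMn mulrAC.
    rewrite ge0_integralZl//; last first.
      by apply/measurable_EFinP/measurable_funX/measurableT_comp.
    apply: (le_trans (lee_wpmul2l _ (moment q))); first by rewrite lee_fin.
    rewrite -EFinM lee_fin.
    rewrite [leLHS](_ : _ = s ^+ 2 * v / 2 * (`|s| * c) ^+ q); last first.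
      have : q.+2`!%:R != 0 :> R by rewrite pnatr_eq0 -lt0n fact_gt0.
      rewrite -[s ^+ 2]real_normK ?num_real// exprMn.
      rewrite (exprS `|s| q.+1) (exprS `|s| q).
      by move: (_`!%:R) (c ^+ q) (`|s| ^+ q) => f x y f0; field.
    apply: ler_wpM2l; first by rewrite divr_ge0// mulr_ge0 ?sqr_ge0// ltW.
    apply: lerXn2r; rewrite ?nnegrE ?divr_ge0//.
    by rewrite mulr_ge0// ltW.
  rewrite sumEFin lee_fin -mulr_sumr.
  have sv0 : 0 <= s ^+ 2 * v by rewrite mulr_ge0 ?sqr_ge0// ltW.
  have : \sum_(0 <= q < n) (1 / 2) ^+ q <= 2 :> R.
    have -> : \sum_(0 <= q < n) (1 / 2) ^+ q = 2 - 2 * (1 / 2) ^+ n :> R.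
      elim: n => [|n IHn]; first by rewrite big_geq// expr0; lra.
      by rewrite big_nat_recr//= IHn exprS; lra.
    by rewrite lerBlDr lerDl mulr_ge0// exprn_ge0.
  by move: (s ^+ 2 * v) sv0 (\sum_(0 <= q < n) _) => x x0 y; nra.
have ixi : P.-integrable setT (EFin \o xi).
  apply/integrableP; split; first exact/measurable_EFinP.
  apply: (@le_lt_trans _ _ (\int[P]_w (1%:E + (`|xi w| ^+ 2)%:E))%E).
    apply: ge0_le_integral => //.
    - by apply/measurable_EFinP; apply: measurableT_comp.
    - by apply/measurable_EFinP; apply: measurable_funD => //;
        apply/measurable_funX/measurableT_comp.
    - by move=> w _; rewrite -EFinD lee_fin expr2; nra.
  rewrite ge0_integralD//; last first.
    by apply/measurable_EFinP; apply/measurable_funX/measurableT_comp.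
  rewrite integral_cst_probability lte_add_pinfty ?ltry//.
  by rewrite (le_lt_trans (moment 0))// ltry.
have il : P.-integrable setT (fun w => (1 + s * xi w)%:E).
  have -> : (fun w => (1 + s * xi w)%:E) = (fun w => 1%:E + s%:E * (xi w)%:E)%E by [].
  apply: integrableD => //; first exact: finite_measure_integrable_cst.
  exact: integrableZl.
have ihh : P.-integrable setT h.
  apply/integrableP; split => //.
  under eq_integral do rewrite gee0_abs//.
  by rewrite (le_lt_trans ih)// ltry.
apply: (@le_trans _ _ (\int[P]_w ((1 + s * xi w)%:E + h w))%E).
  apply: ge0_le_integral => //.
  - apply/measurable_EFinP; apply: measurableT_comp => //; exact: measurable_funM.
  - by apply: emeasurable_funD => //; exact: measurable_int il.
  - by move=> w _; exact: expR_le_nneseries.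
rewrite integralD// EFinD leeD//.
have -> : (fun w => (1 + s * xi w)%:E) = (fun w => 1%:E + s%:E * (xi w)%:E)%E by [].
rewrite integralD//; [|exact: finite_measure_integrable_cst|exact: integrableZl].
rewrite integral_cst_probability integralZl//.
by have := xi_mean; rewrite unlock => ->; rewrite mule0 adde0.
Qed.
End bernstein_moment.

(** * Random matrices *)

Section matrix_measurability.
Context (R : realType).

Lemma measurable_mx_entry (m n : nat) (i : 'I_m) (j : 'I_n) :
  measurable_fun setT (fun A : 'M[R]_(m, n) => A i j).
Proof.
move=> _ B mB; apply: sub_gen_smallest; exists (i, j) => //.
by exists B.
Qed.

Lemma measurable_fun_mx d (U : measurableType d) (m n : nat) (f : U -> 'M[R]_(m, n)) :
  (forall i j, measurable_fun setT (fun u => f u i j)) -> measurable_fun setT f.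
Proof.
move=> mf; pose G := \bigcup_(ij in [set: 'I_m * 'I_n])
  preimage_set_system [set: 'M[R]_(m, n)] (fun A => A ij.1 ij.2) measurable.
apply: (@measurability _ _ _ _ _ _ G) => // A [C [ij _ [B mB <-]] <-].
by rewrite !setTI; have := mf ij.1 ij.2 measurableT B mB; rewrite setTI.
Qed.

Lemma measurable_mx_set1 (m n : nat) (A : 'M[R]_(m, n)) : measurable [set A].
Proof.
have -> : [set A] = \bigcap_(ij in [set: 'I_m * 'I_n])
    ((fun B : 'M[R]_(m, n) => B ij.1 ij.2) @^-1` [set A ij.1 ij.2]).
  apply/seteqP; split => [B -> //|B /= BA].
  by apply/matrixP => i j; exact: (BA (i, j)).
apply: fin_bigcap_measurable => // ij _.
by rewrite -[X in measurable X]setTI; exact: measurable_mx_entry.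
Qed.

Lemma measurable_row (m n : nat) (i : 'I_m) :
  measurable_fun setT (fun A : 'M[R]_(m, n) => row i A).
Proof.
apply: measurable_fun_mx => k j; under eq_fun do rewrite mxE.
exact: measurable_mx_entry.
Qed.

Lemma frobE (d T : nat) (A B : 'M[R]_(d, T)) : frob A B = \sum_i \sum_j A i j * B i j.
Proof.
rewrite /frob /mxtrace exchange_big; apply: eq_bigr => j _.
by rewrite mxE; apply: eq_bigr => i _; rewrite mxE.
Qed.

Lemma frob_delta (d T : nat) (i : 'I_d) (j : 'I_T) (A : 'M[R]_(d, T)) :
  frob (delta_mx i j) A = A i j.
Proof.
rewrite frobE (bigD1 i)//= (bigD1 j)//= mxE !eqxx mul1r.
rewrite [X in _ + X + _]big1 => [|k /negbTE kj]; last by rewrite mxE kj andbF mul0r.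
rewrite big1 ?addr0// => k /negbTE ki; apply: big1 => l _.
by rewrite mxE ki mul0r.
Qed.

Lemma measurable_frob (d T : nat) (A : 'M[R]_(d, T)) :
  measurable_fun setT (fun X : 'M[R]_(d, T) => frob X A).
Proof.
under eq_fun do rewrite frobE.
apply: measurable_sum => i; apply: measurable_sum => j.
by apply: measurable_funM => //; exact: measurable_mx_entry.
Qed.

End matrix_measurability.

Lemma g_sigma_algebra_preimage_measurable d d' (U : measurableType d)
    (V : measurableType d') (f : U -> V) :
  measurable_fun setT f -> g_sigma_algebra_preimage f `<=` measurable.
Proof. by move=> mf A [B mB <-]; exact: mf. Qed.

Lemma measurable_wrt_comp d d' d'' (U : measurableType d)
    (V : measurableType d') (W : measurableType d'') (f : U -> V) (g : V -> W) :
  measurable_fun setT g -> measurable_wrt (g_sigma_algebra_preimage f) (g \o f).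
Proof.
move=> mg B mB; exists (g @^-1` B); last by rewrite setTI.
by rewrite -[X in measurable X]setTI; exact: mg.
Qed.

Section finite_partition.
Context (d : measure_display) (Omega : measurableType d) (R : realType).
Context (P : probability Omega R).

(** Plays the part of conditioning on a discrete variable. The cells cover only almost every point
    because a law carried by the basis matrices constrains the draws only almost surely. *)
Lemma integral_ae_partition (I : finType) (B : I -> set Omega) (f : Omega -> R) :
  (forall i, measurable (B i)) -> (forall i j w, B i w -> B j w -> i = j) ->
  {ae P, forall w, exists i, B i w} ->
  measurable_fun setT f -> (forall w, 0 <= f w) ->
  (\int[P]_w (f w)%:E = \sum_i \int[P]_w (\1_(B i) w * f w)%:E)%E.
Proof.
move=> mB dB aeB mf f0.
have mBf i : measurable_fun setT (fun w => (\1_(B i) w * f w)%:E).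
  by apply/measurable_EFinP; apply: measurable_funM => //; exact: measurable_indic.
rewrite -ge0_integral_sum//; last by move=> i w _; rewrite lee_fin mulr_ge0.
apply: ge0_ae_eq_integral => //.
- exact/measurable_EFinP.
- exact: emeasurable_sum.
- by move=> w _; rewrite lee_fin.
- by move=> w _; apply: sume_ge0 => i _; rewrite lee_fin mulr_ge0.
- apply: filterS aeB => w [i Biw] _.
  rewrite sumEFin (bigD1 i)//= indicE mem_set// mul1r big1 ?addr0// => j ji.
  rewrite indicE memNset ?mul0r// => Bjw.
  by move: ji; rewrite (dB _ _ _ Biw Bjw) eqxx.
Qed.

Lemma integral_indep3 (F1 F2 F3 : set_system Omega) (f1 f2 f3 : Omega -> R) :
  mutually_indep P (tnth [tuple F1; F2; F3]) ->
  F1 `<=` measurable -> F2 `<=` measurable -> F3 `<=` measurable ->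
  measurable_wrt F1 f1 -> measurable_wrt F2 f2 -> measurable_wrt F3 f3 ->
  (forall w, 0 <= f1 w) -> (forall w, 0 <= f2 w) -> (forall w, 0 <= f3 w) ->
  (\int[P]_w (f1 w)%:E < +oo)%E -> (\int[P]_w (f2 w)%:E < +oo)%E ->
  (\int[P]_w (f3 w)%:E < +oo)%E ->
  (\int[P]_w (f1 w * f2 w * f3 w)%:E =
   \int[P]_w (f1 w)%:E * \int[P]_w (f2 w)%:E * \int[P]_w (f3 w)%:E)%E.
Proof.
move=> ind m1 m2 m3 w1 w2 w3 p1 p2 p3 i1 i2 i3.
have := @integral_prod_indep _ _ _ P _ (tnth [tuple F1; F2; F3])
  (tnth [tuple f1; f2; f3]) ind.
rewrite !big_ord_recr !big_ord0/= !mul1e !(tnth_nth f1)/= => <-.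
- apply: eq_integral => w _.
  by rewrite !big_ord_recr big_ord0/= mul1r !(tnth_nth f1).
- by move=> [[|[|[|//]]] ?]; rewrite (tnth_nth F1).
- by move=> [[|[|[|//]]] ?]; rewrite (tnth_nth F1) (tnth_nth f1).
- by move=> [[|[|[|//]]] ?] w; rewrite (tnth_nth f1).
- by move=> [[|[|[|//]]] ?]; under eq_integral do rewrite (tnth_nth f1).
Qed.

End finite_partition.

Section sampling_distribution.
Context (R : realType) (d T : nat) (Pi : probability 'M[R]_(d, T) R).
Hypothesis hPi : Pi (@basis_mx R d T) = 1%E.

Definition basis_elt (jt : 'I_d * 'I_T) : 'M[R]_(d, T) := delta_mx jt.1 jt.2.

Definition weight (jt : 'I_d * 'I_T) : R := fine (Pi [set basis_elt jt]).

Lemma basis_elt_inj : injective basis_elt.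
Proof.
move=> [j t] [j' t'] /matrixP/(_ j t); rewrite /basis_elt !mxE !eqxx /=.
by case: eqP => [->|_]; case: eqP => [->|_] //= /eqP; rewrite oner_eq0.
Qed.

Lemma measurable_basis : measurable (@basis_mx R d T).
Proof.
rewrite /basis_mx (_ : [set _ | _ in _] = \bigcup_(jt in [set: 'I_d * 'I_T]) [set basis_elt jt]).
  by apply: fin_bigcup_measurable => // jt _; exact: measurable_mx_set1.
by apply/seteqP; split => [A [jt _ <-]|A [jt _ ->]]; exists jt.
Qed.

Lemma weight_ge0 jt : 0 <= weight jt.
Proof. exact: fine_ge0. Qed.

Lemma weightE jt : ((weight jt)%:E = Pi [set basis_elt jt])%E.
Proof. by rewrite fineK// fin_num_measure//; exact: measurable_mx_set1. Qed.

Lemma integral_basis (f : 'M[R]_(d, T) -> R) :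
  measurable_fun setT f -> (forall A, 0 <= f A) ->
  (\int[Pi]_A (f A)%:E = (\sum_jt weight jt * f (basis_elt jt))%:E)%E.
Proof.
move=> mf f0.
rewrite (@integral_ae_partition _ _ _ _ _ (fun jt => [set basis_elt jt]))//.
- rewrite -sumEFin; apply: eq_bigr => jt _.
  rewrite (eq_integral (fun A => (f (basis_elt jt))%:E * (\1_[set basis_elt jt] A)%:E)%E).
    rewrite ge0_integralZl ?lee_fin//; last first.
      by apply/measurable_EFinP/measurable_indic; exact: measurable_mx_set1.
    rewrite integral_indic ?setIT//; last exact: measurable_mx_set1.
    by rewrite -[X in (_ * X)%E]/(Pi [set basis_elt jt]) -weightE -EFinM mulrC.
  move=> A _ /=; rewrite -EFinM indicE; congr EFin.
  by case: (boolP (A \in _)) => [/set_mem -> |_]; rewrite ?mul1r ?mulr1 ?mul0r ?mulr0.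
- by move=> jt; exact: measurable_mx_set1.
- by move=> jt jt' A /= -> /basis_elt_inj.
- exists (~` (@basis_mx R d T)); split.
  + by apply: measurableC; exact: measurable_basis.
  + have := probability_setC Pi measurable_basis.
    by rewrite hPi subee.
  + by move=> A /= nA; apply: contra_not nA => -[jt _ <-]; exists jt.
Qed.

Lemma sum_weight : \sum_jt weight jt = 1.
Proof.
apply/EFin_inj; rewrite -[RHS](integral_cst_probability Pi 1).
by rewrite integral_basis//; under [in RHS]eq_bigr do rewrite mulr1.
Qed.

Lemma normPi2E (A : 'M[R]_(d, T)) :
  normPi2 Pi A = \sum_jt weight jt * A jt.1 jt.2 ^+ 2.
Proof.
rewrite /normPi2 /Rintegral integral_basis.
- by apply: eq_bigr => jt _; rewrite frob_delta.
- by apply: measurable_funX; exact: measurable_frob.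
- by move=> B; exact: sqr_ge0.
Qed.

End sampling_distribution.

(** * Exponential moments of the noise *)

Section mx_norm.
Context (R : realType) (m n : nat).
Implicit Types A : 'M[R]_(m, n).

Lemma ler_mx_entry A i j : `|A i j| <= `|A|.
Proof.
rewrite [leRHS](mx_normrE A).
exact: (le_bigmax _ (fun ij : 'I_m * 'I_n => `|A ij.1 ij.2|) (i, j)).
Qed.

Lemma mx_norm_ler A (c : R) : 0 <= c -> (forall i j, `|A i j| <= c) -> `|A| <= c.
Proof.
by move=> c0 Ac; rewrite [leLHS](mx_normrE A); apply: bigmax_le => // -[i j] _.
Qed.

End mx_norm.

Lemma same_law_integral d1 d2 d3 (O1 : measurableType d1) (O2 : measurableType d2)
    (V : measurableType d3) (R : realType) (P : probability O1 R)
    (Q : probability O2 R) (f : O1 -> V) (g : O2 -> V) (phi : V -> R) :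
  measurable_fun setT f -> measurable_fun setT g -> same_law P f Q g ->
  measurable_fun setT phi -> (forall v, 0 <= phi v) ->
  (\int[P]_w (phi (f w))%:E = \int[Q]_w (phi (g w))%:E)%E.
Proof.
move=> mf mg fg mphi phi0.
have mphiE : measurable_fun setT (EFin \o phi) by exact/measurable_EFinP.
have phiE0 : {in [set: V], forall y, (0 <= (EFin \o phi) y)%E}.
  by move=> y _; rewrite lee_fin.
have := ge0_integral_pushforward mf P measurableT mphiE phiE0.
have := ge0_integral_pushforward mg Q measurableT mphiE phiE0.
rewrite !preimage_setT /= => <- <-.
by apply: eq_measure_integral => A mA _; exact: fg.
Qed.

(* [Z] itself is not assumed bounded. Its truncation is bounded, is a function of
   [Z], so that it inherits the mixing coefficients of [Z], and by (A1) it has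
   the law of the rows of [eps]. *)
Section clamp.
Context (R : realType) (m : R) (m0 : 0 < m).

Definition clamp (x : R) : R := Num.max (- m) (Num.min m x).

Lemma clamp_le x : `|clamp x| <= m.
Proof.
rewrite /clamp ler_norml le_max lexx ge_max ge_min lexx /= andbT.
by have := m0; lra.
Qed.

Lemma clamp_id x : `|x| <= m -> clamp x = x.
Proof.
by rewrite ler_norml => /andP[h1 h2]; rewrite /clamp min_r// max_r.
Qed.

Lemma measurable_clamp : measurable_fun [set: R] clamp.
Proof. by apply: measurable_maxr => //; exact: measurable_minr. Qed.

End clamp.

Section row_noise.
Context (R : realType) (d T : nat) (dO : measure_display) (Omega : measurableType dO).
Context (P : probability Omega R) (eps : {RV P >-> 'M[R]_(d, T)}).
Hypothesis heps_iid : iid P (fun (j : 'I_d) (w : Omega) => row j (eps w)).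
Hypothesis heps_mean : forall j t, ('E_P[fun w => eps w j t] = 0)%E.
Context (dZ : measure_display) (OmegaZ : measurableType dZ).
Context (PZ : probability OmegaZ R) (Z : int -> {RV PZ >-> R}).
Hypothesis hA1 : forall j : 'I_d,
     same_law P (fun w => row j (eps w))
              PZ (fun w => \row_(t < T) Z (t.+1)%:Z w).
Context (m : R) (m0 : 0 < m).
Hypothesis heps : {ae P, forall w, `|eps w| <= m}.

Local Notation g := (clamp m).
Local Notation Phi := (mixing_sum PZ Z T).

Lemma measurable_eps : measurable_fun setT eps.
Proof. exact: measurable_funP. Qed.

Let meps j t : measurable_fun setT (fun w => eps w j t).
Proof. exact: (measurableT_comp (@measurable_mx_entry R d T j t) measurable_eps). Qed.

Lemma clamp_eps_ae : {ae P, forall w, forall j t, g (eps w j t) = eps w j t}.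
Proof.
apply: filterS heps => w ew j t; apply: clamp_id.
exact: le_trans (ler_mx_entry _ _ _) ew.
Qed.

Let mrow j : measurable_fun setT (fun w => row j (eps w)).
Proof. exact: (measurableT_comp (@measurable_row R d T j) measurable_eps). Qed.

Let mrowZ : measurable_fun setT (fun w => \row_(t < T) Z (t.+1)%:Z w).
Proof.
apply: measurable_fun_mx => i t; under eq_fun do rewrite mxE.
exact: measurable_funP.
Qed.

Let mg : measurable_fun [set: R] g. Proof. exact: measurable_clamp. Qed.

(** The mean is read off row [j] of [eps], where truncation is almost surely the identity. Adding
    [m] to the test function makes it nonnegative, as the transport of laws by [same_law_integral]
    demands. *)
Lemma clamp_Z_mean (j : 'I_d) t : (t < T)%N -> \int[PZ]_w g (Z t.+1%:Z w) = 0.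
Proof.
move=> tT; pose phi (v : 'rV[R]_T) := g (v ord0 (Ordinal tT)) + m.
have mphi : measurable_fun setT phi.
  apply: measurable_funD => //; apply: measurableT_comp => //.
  exact: measurable_mx_entry.
have phi0 v : 0 <= phi v.
  by have := clamp_le m0 (v ord0 (Ordinal tT)); rewrite ler_norml /phi; lra.
have := same_law_integral (mrow j) mrowZ (hA1 j) mphi phi0.
have bZ : bmeasurable (fun w => g (Z t.+1%:Z w)).
  by split; [exact: measurableT_comp | exists m => w; exact: clamp_le].
have be : bmeasurable (fun w => g (eps w j (Ordinal tT))).
  by split; [exact: measurableT_comp | exists m => w; exact: clamp_le].
rewrite /phi.
under eq_integral do rewrite mxE.
under [RHS]eq_integral do rewrite mxE.
rewrite -!EFin_Rintegral; [|exact: bmeasurableD (bmeasurable_cst _ _)..].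
rewrite !bmeasurable_RintegralD//; [|exact: bmeasurable_cst..].
rewrite !Rintegral_cst_probability => -[/addIr <-].
apply: EFin_inj; rewrite EFin_Rintegral//.
rewrite -[RHS](heps_mean j (Ordinal tT)) unlock.
apply: ae_eq_integral => //.
- by apply/measurable_EFinP; case: be.
- exact/measurable_EFinP.
- by apply: filterS clamp_eps_ae => w -> _.
Qed.

Lemma row_noise_moment (j : 'I_d) (c : 'I_T -> R) :
  (\int[P]_w (expR (\sum_t c t * g (eps w j t)))%:E <=
   (expR (4 * m ^+ 2 * Phi ^+ 2 * \sum_t c t ^+ 2))%:E)%E.
Proof.
(* The moment bound for the process takes coefficients indexed by [nat]; the default 0 lies outside
   the range of summation. *)
pose c' (l : nat) := if insub l is Some t then c t else 0.
have c'E (t : 'I_T) : c' t = c t by rewrite /c' valK.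
pose phi (v : 'rV[R]_T) := expR (\sum_t c t * g (v ord0 t)).
have mphi : measurable_fun setT phi.
  apply: measurableT_comp => //; apply: measurable_sum => t.
  apply: measurable_funM => //; apply: measurableT_comp => //.
  exact: measurable_mx_entry.
have phi0 v : 0 <= phi v by exact: expR_ge0.
have := same_law_integral (mrow j) mrowZ (hA1 j) mphi phi0; rewrite /phi.
under eq_integral do under eq_bigr do rewrite mxE.
under [RHS]eq_integral do under eq_bigr do rewrite mxE.
move=> ->.
have h := @mixing_exponential_moment _ _ _ PZ Z g m c' mg m0 (clamp_le m0) T
  (fun t tT => clamp_Z_mean j tT).
rewrite -lee_fin EFin_Rintegral in h; last first.
  apply: bmeasurable_expR; apply: bmeasurable_sum => l; apply: bmeasurableZ.
  by split; [exact: measurableT_comp | exists m => w; exact: clamp_le].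
apply: le_trans (le_trans _ h) _.
  rewrite le_eqVlt; apply/orP; left; apply/eqP; apply: eq_integral => w _.
  by congr (expR _)%:E; apply: eq_bigr => t _; rewrite c'E.
by rewrite le_eqVlt; apply/orP; left; apply/eqP; congr (expR (_ * _))%:E;
  apply: eq_bigr => t _; rewrite c'E.
Qed.

Lemma matrix_noise_moment (c : 'I_d -> 'I_T -> R) :
  (\int[P]_w (expR (\sum_j \sum_t c j t * g (eps w j t)))%:E <=
   (expR (4 * m ^+ 2 * Phi ^+ 2 * \sum_j \sum_t c j t ^+ 2))%:E)%E.
Proof.
under eq_integral do rewrite expR_sum.
have moment j := row_noise_moment j (c j).
rewrite (integral_prod_indep heps_iid.1).
- rewrite mulr_sumr expR_sum -prodEFin.
  apply: lee_prod => j; last exact: moment.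
  by apply: integral_ge0 => w _; rewrite lee_fin expR_ge0.
- by move=> j; apply: g_sigma_algebra_preimage_measurable.
- move=> j; pose phi (v : 'rV[R]_T) := expR (\sum_t c j t * g (v ord0 t)).
  have mphi : measurable_fun setT phi.
    apply: measurableT_comp => //; apply: measurable_sum => t.
    apply: measurable_funM => //; apply: measurableT_comp => //.
    exact: measurable_mx_entry.
  have := @measurable_wrt_comp _ _ _ _ _ _ (fun w => row j (eps w)) phi mphi.
  rewrite (_ : phi \o _ = fun w => expR (\sum_t c j t * g (eps w j t)))//.
  by apply/funext => w /=; congr expR; apply: eq_bigr => t _; rewrite mxE.
- by move=> j w; exact: expR_ge0.
- by move=> j; rewrite (le_lt_trans (moment j))// ltry.
Qed.

End row_noise.

Section noise.
Context (R : realType) (n : nat) (dO : measure_display) (Omega : measurableType dO).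
Context (P : probability Omega R) (xi : 'I_n -> {RV P >-> R}).
Hypothesis hxi_iid : iid P xi.
Context (c v : R).
Hypotheses (c0 : 0 < c) (v0 : 0 < v).
Hypothesis xi_mean : forall i, ('E_P[xi i] = 0)%E.
Hypothesis xi2 : forall i, ('E_P[fun w => (xi i w ^+ 2)%R] <= v%:E)%E.
Hypothesis xiq : forall i (q : nat), (3 <= q)%N ->
  ('E_P[fun w => (`|xi i w| ^+ q)%R] <= (v * c ^+ (q - 2) * (q`!)%:R / 2)%:E)%E.

Lemma integral_prod_noise (f : 'I_n -> R -> R) (b : 'I_n -> R) :
  (forall i, measurable_fun [set: R] (f i)) -> (forall i x, 0 <= f i x) ->
  (forall i, (\int[P]_w (f i (xi i w))%:E <= (b i)%:E)%E) ->
  (\int[P]_w (\prod_i f i (xi i w))%:E <= (\prod_i b i)%:E)%E.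
Proof.
move=> mf f0 fb; rewrite (integral_prod_indep hxi_iid.1 (f := fun i w => f i (xi i w))).
- rewrite -prodEFin; apply: lee_prod => // i.
  by apply: integral_ge0 => w _; rewrite lee_fin.
- by move=> i; apply: g_sigma_algebra_preimage_measurable.
- by move=> i; exact: measurable_wrt_comp.
- by [].
- by move=> i; rewrite (le_lt_trans (fb i))// ltry.
Qed.

Lemma noise_moment (a : 'I_n -> R) : (forall i, `|a i| * c <= 1 / 2) ->
  (\int[P]_w (expR (\sum_i a i * xi i w))%:E <= (expR (\sum_i a i ^+ 2 * v))%:E)%E.
Proof.
move=> ac; under eq_integral do rewrite expR_sum.
rewrite expR_sum; apply: (integral_prod_noise (f := fun i x => expR (a i * x))).
- by move=> i; apply: measurableT_comp => //; exact: measurable_funM.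
- by move=> i x; exact: expR_ge0.
- move=> i; apply: le_trans (bernstein_expR_moment c0 v0 (xi_mean i) (xi2 i) (xiq i) (ac i)) _.
  by rewrite lee_fin expR_ge1Dx.
Qed.

(** The noise is unbounded and its total size multiplies the discretization error. Bound
    [expR (s |x|)] by [expR (s x) + expR (- s x)]: each has mean at most [3 / 2], and
    [3 <= expR 2]. *)
Lemma abs_noise_moment (s : R) : 0 <= s -> s * c <= 1 / 2 -> s ^+ 2 * v <= 1 / 2 ->
  (\int[P]_w (expR (s * \sum_i `|xi i w|))%:E <= (expR (2 * n%:R))%:E)%E.
Proof.
move=> s0 sc sv; under eq_integral do rewrite mulr_sumr expR_sum.
rewrite (_ : expR (2 * n%:R) = \prod_(i < n) expR 2); last first.
  by rewrite prodr_const card_ord expRM_natr.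
apply: (integral_prod_noise (f := fun i x => expR (s * `|x|))).
- by move=> i; apply: measurableT_comp => //; apply: measurable_funM => //;
    exact: measurableT_comp.
- by move=> i x; exact: expR_ge0.
- move=> i; apply: (@le_trans _ _
    (\int[P]_w ((expR (s * xi i w))%:E + (expR ((- s) * xi i w))%:E))%E).
    apply: ge0_le_integral => //.
    + apply/measurable_EFinP; apply: measurableT_comp => //.
      by apply: measurable_funM => //; exact: measurableT_comp.
    + apply/measurable_EFinP; apply: measurable_funD; apply: measurableT_comp => //;
      exact: measurable_funM.
    + move=> w _; rewrite -EFinD lee_fin.
      by case: (ler0P (xi i w)) => _; rewrite ?mulrN -?mulNr ?lerDr ?lerDl expR_ge0.
  rewrite ge0_integralD//; last 2 first.
  + by apply/measurable_EFinP; apply: measurableT_comp => //; exact: measurable_funM.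
  + by apply/measurable_EFinP; apply: measurableT_comp => //; exact: measurable_funM.
  have sc1 : `|s| * c <= 1 / 2 by rewrite ger0_norm.
  have sc2 : `|- s| * c <= 1 / 2 by rewrite normrN.
  apply: le_trans (leeD (bernstein_expR_moment c0 v0 (xi_mean i) (xi2 i) (xiq i) sc1)
    (bernstein_expR_moment c0 v0 (xi_mean i) (xi2 i) (xiq i) sc2)) _.
  rewrite -EFinD lee_fin sqrrN; have := expR_ge1Dx (2 : R); lra.
Qed.

End noise.

(** * Exponential moment of the empirical excess risk *)

Definition excess (R : realType) (d T n : nat) (X : 'I_n -> 'M[R]_(d, T))
    (e : 'M[R]_(d, T)) (x : 'I_n -> R) (D : 'M[R]_(d, T)) : R :=
  \sum_i (2 * (x i + frob (X i) e) * frob (X i) D - frob (X i) D ^+ 2).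

Section sample_cells.
Context (R : realType) (d T n : nat) (dO : measure_display) (Omega : measurableType dO).
Context (P : probability Omega R) (X : 'I_n -> {RV P >-> 'M[R]_(d, T)}).
Context (Pi : probability 'M[R]_(d, T) R).
Hypothesis hPi : Pi (@basis_mx R d T) = 1%E.
Hypothesis hX_iid : iid P X.
Hypothesis hX_law : forall i A, measurable A -> distribution P (X i) A = Pi A.

Local Notation J := ('I_d * 'I_T)%type.

Definition sample_cell (x : {ffun 'I_n -> J}) : set Omega :=
  [set w | forall i, X i w = basis_elt R (x i)].

Lemma sample_cellE x :
  sample_cell x = \bigcap_(i in [set: 'I_n]) (X i @^-1` [set basis_elt R (x i)]).
Proof. by apply/seteqP; split => w /= Xw i => [_|]; exact: Xw. Qed.

Let mX i : measurable_fun setT (X i). Proof. exact: measurable_funP. Qed.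

Lemma sample_cell_sigma_gen x : sigma_gen [set: 'I_n] X (sample_cell x).
Proof.
rewrite sample_cellE; pose G := \bigcup_(i in [set: 'I_n])
  preimage_set_system [set: Omega] (X i) measurable.
apply: (@fin_bigcap_measurable _ (g_sigma_algebraType G)) => // i _.
apply: (measurable_wrt_sigma_gen (Z := X)) => //; exact: measurable_mx_set1.
Qed.

Lemma measurable_sample_cell x : measurable (sample_cell x).
Proof. by apply: (sigma_gen_measurable mX); exact: sample_cell_sigma_gen. Qed.

Lemma probability_sample_cell x :
  (P (sample_cell x) = (\prod_i weight Pi (x i))%:E)%E.
Proof.
have := hX_iid.1 [set: 'I_n]%SET (fun i => X i @^-1` [set basis_elt R (x i)]).
have -> : [set` [set: 'I_n]%SET] = [set: 'I_n] by apply/seteqP; split => i //= _; rewrite inE.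
rewrite -sample_cellE => ->.
  rewrite -prodEFin; apply: eq_big => [i|i _]; first by rewrite inE.
  rewrite weightE -(hX_law i)//; exact: measurable_mx_set1.
move=> i _; exists [set basis_elt R (x i)]; first exact: measurable_mx_set1.
by rewrite setTI.
Qed.

Lemma sample_cell_ae : {ae P, forall w, exists x, sample_cell x w}.
Proof.
have aei : {ae P, forall w, forall i, exists jt, X i w = basis_elt R jt}.
  apply: filter_forall => i.
  have mB : measurable (X i @^-1` @basis_mx R d T).
    by rewrite -[X in measurable X]setTI; apply: mX => //; exact: measurable_basis.
  exists (~` (X i @^-1` @basis_mx R d T)); split.
  - exact: measurableC.
  - have := probability_setC P mB.
    have -> : P (X i @^-1` @basis_mx R d T) = 1%E.
      by rewrite -hPi -(hX_law i)//; exact: measurable_basis.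
    by rewrite subee.
  - by move=> w /= nw; apply: contra_not nw => -[jt _ jtE]; exists jt.
apply: filterS aei => w /choice[f fE].
by exists [ffun i => f i] => i; rewrite ffunE.
Qed.

End sample_cells.

Section risk_moment.
Context (R : realType) (d T n : nat) (dO : measure_display) (Omega : measurableType dO).
Context (P : probability Omega R) (X : 'I_n -> {RV P >-> 'M[R]_(d, T)}).
Context (xi : 'I_n -> {RV P >-> R}) (eps : {RV P >-> 'M[R]_(d, T)}).
Context (Pi : probability 'M[R]_(d, T) R).
Hypothesis hPi : Pi (@basis_mx R d T) = 1%E.
Hypothesis hX_iid : iid P X.
Hypothesis hX_law : forall i A, measurable A -> distribution P (X i) A = Pi A.
Hypothesis hxi_iid : iid P xi.
Hypothesis hxi_mean : forall i, ('E_P[xi i] = 0)%E.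
Hypothesis heps_iid : iid P (fun (j : 'I_d) (w : Omega) => row j (eps w)).
Hypothesis heps_mean : forall j t, ('E_P[fun w => eps w j t] = 0)%E.
Hypothesis h_indep : mutually_indep P
     (tnth [tuple sigma_gen [set: 'I_n] X; sigma_gen [set: 'I_n] xi;
                  g_sigma_algebra_preimage eps]).
Context (dZ : measure_display) (OmegaZ : measurableType dZ).
Context (PZ : probability OmegaZ R) (Z : int -> {RV PZ >-> R}).
Hypothesis hA1 : forall j : 'I_d,
     same_law P (fun w => row j (eps w))
              PZ (fun w => \row_(t < T) Z (t.+1)%:Z w).
Context (meps : R) (hmeps : 0 < meps).
Hypothesis heps : {ae P, forall w, `|eps w| <= meps}.
Context (c v : R) (c0 : 0 < c) (v0 : 0 < v).
Hypothesis xi2 : forall i, ('E_P[fun w => (xi i w ^+ 2)%R] <= v%:E)%E.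
Hypothesis xiq : forall i (q : nat), (3 <= q)%N ->
  ('E_P[fun w => (`|xi i w| ^+ q)%R] <= (v * c ^+ (q - 2) * (q`!)%:R / 2)%:E)%E.
Context (cPi : R) (cPi0 : 0 < cPi).
Hypothesis hA3 : forall jt, n%:R * weight Pi jt <= cPi.
Context (m0 L : R) (hm0 : 0 < m0) (L0 : 0 < L).
Hypothesis Lm0 : 16 * m0 ^+ 2 <= L.
Hypothesis Lv : 16 * v <= L.
Hypothesis Lmeps : 16 * meps ^+ 2 <= L.
Hypothesis Lc : 16 * m0 * c <= L.
Hypothesis LPhi : 8 * meps ^+ 2 * mixing_sum PZ Z T ^+ 2 * cPi <= L.
Context (D : 'M[R]_(d, T)) (hD : forall j t, `|D j t| <= 2 * m0).
Context (sg : R) (hsg : `|sg| = 1).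

Local Notation J := ('I_d * 'I_T)%type.
Local Notation p := (weight Pi).
Local Notation g := (clamp meps).
Let mu := (16 * L)^-1.
Let DD (jt : J) := D jt.1 jt.2.
Let N := \sum_jt p jt * DD jt ^+ 2.

Let risk_gap w := excess (fun i => X i w) (eps w) (fun i => xi i w) D.

Let mu0 : 0 < mu. Proof. by rewrite invr_gt0 mulr_gt0. Qed.
Let muL : mu * L = 1 / 16.
Proof. by rewrite /mu; field; rewrite gt_eqF. Qed.

Let p0 jt : 0 <= p jt. Proof. exact: weight_ge0. Qed.

(** Contribution of one draw at position [jt] once [xi] is integrated, for a frozen noise entry [e]:
    the term [4 * mu ^+ 2 * DD jt ^+ 2 * v] is the Bernstein bound with parameter
    [2 * sg * mu * DD jt]. *)
Let q (jt : J) (e : R) :=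
  p jt * expR (4 * mu ^+ 2 * DD jt ^+ 2 * v + sg * mu * (2 * e * DD jt - DD jt ^+ 2)).

(** Second-order expansion of the exponential. The coefficient [5 / 2] covers [1 / 4], from the
    Bernstein term since [16 * v <= L], and [2 * 33 / 32], from twice the square of the whole
    exponent [y]. *)
Let q_le jt e : `|e| <= meps ->
  q jt e <= p jt * (1 + sg * mu * (2 * e * DD jt - DD jt ^+ 2)
                      + 5 / 2 * mu ^+ 2 * L * DD jt ^+ 2).
Proof.
move=> em; rewrite /q ler_wpM2l//.
set a := DD jt; set y := _ + _.
have a2 : `|a| <= 2 * m0 by exact: hD.
have aa : `|a| ^+ 2 = a ^+ 2 by rewrite real_normK ?num_real.
have muv : mu * v <= 1 / 256 by have := ler_wpM2l (ltW mu0) Lv; rewrite muL; lra.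
have ya : `|y| <= mu * `|a| * (2 * meps + 65 / 32 * m0).
  have h1 : `|4 * mu ^+ 2 * a ^+ 2 * v| <= mu * `|a| * (m0 / 32).
    rewrite ger0_norm; last first.
      by rewrite mulr_ge0 ?(ltW v0)// mulr_ge0 ?sqr_ge0// mulr_ge0 ?sqr_ge0.
    rewrite -aa (_ : _ * v = 4 * (mu * `|a|) * `|a| * (mu * v)); last by ring.
    have : 0 <= mu * `|a| by rewrite mulr_ge0 ?(ltW mu0).
    move: (mu * `|a|) (normr_ge0 a) => z a0 z0.
    have : `|a| * (mu * v) <= 2 * m0 * (1 / 256).
      by apply: ler_pM => //; rewrite mulr_ge0 ?(ltW mu0) ?(ltW v0).
    nra.
  have h2 : `|sg * mu * (2 * e * a - a ^+ 2)| <= mu * `|a| * (2 * meps + 2 * m0).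
    rewrite !normrM hsg mul1r (gtr0_norm mu0) -[leRHS]mulrA ler_wpM2l ?(ltW mu0)//.
    rewrite (_ : 2 * e * a - a ^+ 2 = a * (2 * e - a)); last by ring.
    rewrite normrM ler_wpM2l// (le_trans (ler_normB _ _))// lerD//.
    by rewrite normrM ger0_norm// ler_wpM2l.
  rewrite (le_trans (ler_normD _ _))//.
  apply: le_trans (lerD h1 h2) _.
  by rewrite le_eqVlt; apply/orP; left; apply/eqP; field.
set k := 2 * meps + 65 / 32 * m0 in ya.
have k0 : 0 <= k by rewrite addr_ge0 ?mulr_ge0// ?divr_ge0// ltW.
(* From [(x + y)^2 <= 2 x^2 + 2 y^2]: the part in [meps] is at most [L / 2], the part in [m0] at
   most [17 / 32 * L]. *)
have k2 : k ^+ 2 <= 33 / 32 * L.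
  rewrite /k; have := sqr_ge0 (2 * meps - 65 / 32 * m0); have := sqr_ge0 m0.
  by have := Lm0; have := Lmeps; rewrite !expr2; nra.
have y1 : y <= 1.
  rewrite (le_trans (ler_norm _))// (le_trans ya)//.
  apply: (@le_trans _ _ (mu * (2 * m0) * k)).
    by rewrite ler_wpM2r// ler_wpM2l// ltW.
  rewrite -mulrA; have : 2 * m0 * k <= L.
    by have := sqr_ge0 (4 * m0 - k); have := Lm0; have := L0; move: k2; rewrite !expr2; lra.
  by move=> /(ler_wpM2l (ltW mu0)); rewrite muL; lra.
have y2 : y ^+ 2 <= mu ^+ 2 * a ^+ 2 * (33 / 32 * L).
  rewrite -[y ^+ 2]real_normK ?num_real//.
  apply: (@le_trans _ _ ((mu * `|a| * k) ^+ 2)).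
    by apply: lerXn2r; rewrite ?nnegrE// mulr_ge0// mulr_ge0// ltW.
  rewrite !exprMn aa ler_wpM2l//; last by rewrite mulr_ge0 ?sqr_ge0.
have m2 : 0 <= mu ^+ 2 * a ^+ 2 by rewrite mulr_ge0 ?sqr_ge0.
rewrite (le_trans (expR_le_quadratic y1))//.
have : 4 * mu ^+ 2 * a ^+ 2 * v <= mu ^+ 2 * a ^+ 2 * (L / 4).
  rewrite (_ : 4 * mu ^+ 2 * a ^+ 2 * v = mu ^+ 2 * a ^+ 2 * (4 * v)); last by ring.
  by rewrite ler_wpM2l//; have := Lv; lra.
rewrite (_ : 5 / 2 * mu ^+ 2 * L * a ^+ 2 = mu ^+ 2 * a ^+ 2 * (5 / 2 * L)); last by ring.
have : 0 <= mu ^+ 2 * a ^+ 2 * L by rewrite mulr_ge0// ltW.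
rewrite {1}/y; move: (mu ^+ 2 * a ^+ 2) m2 y2 => z z0.
by move: (y ^+ 2) (4 * _ * _ * v) (sg * mu * _) => yy q1 q2; lra.
Qed.

(** Passing back to an exponential with [1 + x <= expR x] makes the [n]-th power an exponential of a
    linear form in the noise, which is what [matrix_noise_moment] estimates. *)
Let sum_q_le (e : J -> R) : (forall jt, `|e jt| <= meps) ->
  \sum_jt q jt (e jt) <= expR (2 * sg * mu * (\sum_jt p jt * DD jt * e jt)
     + (5 / 2 * mu ^+ 2 * L - sg * mu) * N).
Proof.
move=> em; rewrite (le_trans _ (expR_ge1Dx _))// -[X in _ <= X + _](sum_weight hPi) /N.
rewrite !mulr_sumr -!big_split/=; apply: ler_sum => jt _.
rewrite (le_trans (q_le _ (em jt)))// le_eqVlt; apply/orP; left; apply/eqP; ring.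
Qed.

Let mX i : measurable_fun setT (X i). Proof. exact: measurable_funP. Qed.
Let mxi i : measurable_fun setT (xi i). Proof. exact: measurable_funP. Qed.
Let meps' : measurable_fun setT eps. Proof. exact: measurable_funP. Qed.
Let mg : measurable_fun [set: R] g. Proof. exact: measurable_clamp. Qed.

Let mge (jt : J) : measurable_fun setT (fun w => g (eps w jt.1 jt.2)).
Proof.
apply: measurableT_comp => //.
exact: (measurableT_comp (@measurable_mx_entry R d T jt.1 jt.2) meps').
Qed.

Lemma measurable_excess :
  measurable_fun setT (fun w => excess (fun i => X i w) (eps w) (fun i => xi i w) D).
Proof.
have mfX (i : 'I_n) : measurable_fun setT (fun w => frob (X i w) D).
  exact: (measurableT_comp (measurable_frob D)).
apply: measurable_sum => i; apply: measurable_funB; last exact: measurable_funX.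
apply: measurable_funM => //; apply: measurable_funM => //.
apply: measurable_funD => //; under eq_fun do rewrite frobE.
apply: measurable_sum => j; apply: measurable_sum => t; apply: measurable_funM.
  exact: (measurableT_comp (@measurable_mx_entry R d T j t)).
exact: (measurableT_comp (@measurable_mx_entry R d T j t)).
Qed.

Let risk_gap_cell x w : sample_cell X x w ->
  risk_gap w = \sum_i (2 * DD (x i)) * xi i w +
    \sum_i (2 * eps w (x i).1 (x i).2 * DD (x i) - DD (x i) ^+ 2).
Proof.
move=> xw; rewrite -big_split/=; apply: eq_bigr => i _.
by rewrite xw /basis_elt !frob_delta /DD; ring.
Qed.

Let f3 (x : {ffun 'I_n -> J}) (A : 'M[R]_(d, T)) :=
  expR (sg * mu * \sum_i (2 * A (x i).1 (x i).2 * DD (x i) - DD (x i) ^+ 2)).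

Let mf3 x : measurable_fun setT (f3 x).
Proof.
apply: measurableT_comp => //; apply: measurable_funM => //.
apply: measurable_sum => i; apply: measurable_funB => //.
apply: measurable_funM => //; apply: measurable_funM => //.
exact: measurable_mx_entry.
Qed.

(** The bound on [eps] holds almost surely, whereas [sum_q_le] is applied at every [w]. *)
Let clamped w : 'M[R]_(d, T) := map_mx g (eps w).

Let bf3 x : bmeasurable (fun w => f3 x (clamped w)).
Proof.
apply: bmeasurable_expR; apply: bmeasurableZ; apply: bmeasurable_sum => i.
apply: bmeasurableB; last exact: bmeasurable_cst.
apply: bmeasurableM; last exact: bmeasurable_cst.
apply: bmeasurableZ; split.
  by under eq_fun do rewrite mxE; exact: mge.
by exists meps => w; rewrite mxE; exact: clamp_le.
Qed.

Let clampedE : {ae P, forall w, clamped w = eps w}.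
Proof.
apply: filterS (clamp_eps_ae heps) => w ge.
by apply/matrixP => j t; rewrite mxE.
Qed.

Let int_f3 x : (\int[P]_w (f3 x (eps w))%:E = \int[P]_w (f3 x (clamped w))%:E)%E.
Proof.
apply: ge0_ae_eq_integral => //.
- by apply/measurable_EFinP; apply: measurableT_comp.
- by apply/measurable_EFinP; case: (bf3 x).
- by move=> w _; rewrite lee_fin expR_ge0.
- by move=> w _; rewrite lee_fin expR_ge0.
- by apply: filterS clampedE => w -> _.
Qed.

(** On a cell the draws are constants, so the integrand is a product of functions of [X], [xi] and
    [eps], and independence splits the integral in three. The factor in [eps] is not estimated here:
    the cells have to be summed first, under the integral. *)
Let cell_moment x :
  (\int[P]_w (\1_(sample_cell X x) w * expR (sg * mu * risk_gap w))%:E <=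
   \int[P]_w (\prod_i q (x i) (clamped w (x i).1 (x i).2))%:E)%E.
Proof.
pose a (i : 'I_n) := sg * mu * (2 * DD (x i)).
pose f2 w := expR (\sum_i a i * xi i w).
have am i : `|a i| * c <= 1 / 2.
  rewrite /a !normrM hsg mul1r (gtr0_norm mu0) (ger0_norm (ler0n _ 2)).
  have h : mu * (16 * m0 * c) <= 1 / 16 by rewrite -muL ler_wpM2l// ltW.
  have h2 : `|DD (x i)| * (mu * c) <= 2 * m0 * (mu * c).
    by apply: ler_wpM2r; [rewrite mulr_ge0// ltW | exact: hD].
  lra.
have nm := noise_moment hxi_iid c0 v0 hxi_mean xi2 xiq am.
rewrite (eq_integral (fun w => (\1_(sample_cell X x) w * f2 w * f3 x (eps w))%:E)); last first.
  move=> w _; rewrite indicE -[in RHS]mulrA;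
  case: (boolP (w \in _)) => [/set_mem xw|_]; last by rewrite !mul0r.
  rewrite !mul1r (risk_gap_cell xw). rewrite mulrDr expRD /f2 mulr_sumr.
  by congr (expR _ * _)%:E; apply: eq_bigr => i _; rewrite /a mulrA.
rewrite (integral_indep3 h_indep).
- rewrite integral_indic ?setIT//; last exact: measurable_sample_cell.
  rewrite -[X in (X * _ * _)%E]/(P (sample_cell X x)).
  rewrite (probability_sample_cell hX_iid hX_law) int_f3.
  apply: (@le_trans _ _ ((\prod_i p (x i))%:E * (expR (\sum_i a i ^+ 2 * v))%:E *
     \int[P]_w (f3 x (clamped w))%:E)%E).
    apply: lee_wpmul2r; first by apply: integral_ge0 => w _; rewrite lee_fin expR_ge0.
    by apply: lee_wpmul2l => //; rewrite lee_fin prodr_ge0.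
  rewrite -EFinM -ge0_integralZl//; last 3 first.
  + by apply/measurable_EFinP; case: (bf3 x).
  + by move=> w _; rewrite lee_fin expR_ge0.
  + by rewrite lee_fin mulr_ge0 ?prodr_ge0// expR_ge0.
  rewrite le_eqVlt; apply/orP; left; apply/eqP; apply: eq_integral => w _.
  rewrite -EFinM -mulrA -expRD /q [in RHS]big_split/= -expR_sum; congr (_ * expR _)%:E.
  rewrite mulr_sumr -big_split/=; apply: eq_bigr => i _.
  rewrite /a !exprMn -[sg ^+ 2]real_normK ?num_real// hsg; ring.
- by apply: sigma_gen_measurable.
- by apply: sigma_gen_measurable.
- exact: g_sigma_algebra_preimage_measurable.
- pose G := \bigcup_(i in [set: 'I_n])
    preimage_set_system [set: Omega] (X i) measurable.
  apply/(measurable_wrt_gP G); apply: measurable_indic.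
  exact: sample_cell_sigma_gen.
- pose G := \bigcup_(i in [set: 'I_n])
    preimage_set_system [set: Omega] (xi i) measurable.
  apply/(measurable_wrt_gP G); apply: measurableT_comp => //.
  apply: measurable_sum => i; apply: measurable_funM => //.
  by apply/measurable_wrt_gP; exact: (measurable_wrt_sigma_gen (Z := xi)).
- exact: measurable_wrt_comp.
- by [].
- by move=> w; exact: expR_ge0.
- by move=> w; exact: expR_ge0.
- rewrite integral_indic// ?setIT; last exact: measurable_sample_cell.
  by rewrite (le_lt_trans (probability_le1 _ (measurable_sample_cell _ _)))// ltry.
- by rewrite (le_lt_trans nm)// ltry.
- by rewrite int_f3 -EFin_Rintegral// ltry.
Qed.

Let mq jt : measurable_fun setT (fun w => q jt (clamped w jt.1 jt.2)).
Proof.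
apply: measurable_funM => //; apply: measurableT_comp => //.
apply: measurable_funD => //; apply: measurable_funM => //.
apply: measurable_funB => //; apply: measurable_funM => //.
by apply: measurable_funM => //; under eq_fun do rewrite mxE; exact: mge.
Qed.

Let q0 jt e : 0 <= q jt e.
Proof. by rewrite mulr_ge0// expR_ge0. Qed.

Let sum_cells w : \sum_(x : {ffun 'I_n -> J}) \prod_i q (x i) (clamped w (x i).1 (x i).2) =
  (\sum_jt q jt (clamped w jt.1 jt.2)) ^+ n.
Proof.
rewrite -[in RHS](card_ord n) -prodr_const.
by rewrite (bigA_distr_bigA (fun i jt => q jt (clamped w jt.1 jt.2))).
Qed.

Lemma risk_moment :
  (\int[P]_w
     (expR (sg * mu * excess (fun i => X i w) (eps w) (fun i => xi i w) D))%:E <=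
   (expR (n%:R * mu * normPi2 Pi D * (1 / 2 - sg)))%:E)%E.
Proof.
rewrite (normPi2E hPi) -/N.
have N0 : 0 <= N by apply: sumr_ge0 => jt _; rewrite mulr_ge0 ?sqr_ge0.
rewrite (integral_ae_partition (B := sample_cell X)); last 5 first.
- by move=> x; exact: measurable_sample_cell.
- move=> x y w xw yw; apply/ffunP => i; apply: (@basis_elt_inj R).
  by rewrite -xw -yw.
- exact: sample_cell_ae hPi hX_law.
- apply: measurableT_comp => //; apply: measurable_funM => //.
  exact: measurable_excess.
- by move=> w; exact: expR_ge0.
apply: (@le_trans _ _ (\sum_(x : {ffun 'I_n -> J})
    \int[P]_w (\prod_i q (x i) (clamped w (x i).1 (x i).2))%:E)%E).
  by apply: lee_sum => x _; exact: cell_moment.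
rewrite -ge0_integral_sum//; last first.
- by move=> x w wT; rewrite lee_fin; apply: prodr_ge0 => i iT; exact: q0.
- by move=> x; apply/measurable_EFinP; apply: measurable_prod.
under eq_integral do rewrite sumEFin sum_cells.
pose a j t := n%:R * (2 * sg * mu) * (p (j, t) * D j t).
pose K := n%:R * ((5 / 2 * mu ^+ 2 * L - sg * mu) * N).
apply: (@le_trans _ _ (\int[P]_w ((expR K)%:E *
    (expR (\sum_j \sum_t a j t * g (eps w j t)))%:E))%E).
  apply: ge0_le_integral => //.
  - by move=> w _; rewrite lee_fin exprn_ge0// sumr_ge0.
  - by apply/measurable_EFinP; apply: measurable_funX; exact: measurable_sum.
  - apply: emeasurable_funM => //; apply/measurable_EFinP.
    apply: measurableT_comp => //; apply: measurable_sum => j.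
    by apply: measurable_sum => t; apply: measurable_funM => //; exact: (mge (j, t)).
  - move=> w _; rewrite -EFinM lee_fin -expRD.
    have := sum_q_le (e := fun jt => clamped w jt.1 jt.2).
    move=> /(_ (fun jt => _)) sq.
    apply: (@le_trans _ _ (expR (2 * sg * mu * (\sum_jt p jt * DD jt * clamped w jt.1 jt.2)
     + (5 / 2 * mu ^+ 2 * L - sg * mu) * N) ^+ n)).
      apply: lerXn2r; rewrite ?nnegrE ?expR_ge0//; first exact: sumr_ge0.
      by apply: sq => jt; rewrite mxE; exact: clamp_le.
    rewrite -expRM_natl mulrDr addrC le_eqVlt; apply/orP; left; apply/eqP.
    congr (expR (_ + _)); rewrite pair_bigA/= mulrA mulr_sumr.
    by apply: eq_bigr => -[j t] _; rewrite /a /DD mxE/=; ring.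
rewrite ge0_integralZl ?lee_fin ?expR_ge0//; last first.
  apply/measurable_EFinP; apply: measurableT_comp => //; apply: measurable_sum => j.
  by apply: measurable_sum => t; apply: measurable_funM => //; exact: (mge (j, t)).
apply: le_trans (lee_wpmul2l _ (matrix_noise_moment heps_iid heps_mean hA1 hmeps heps a)) _.
  by rewrite lee_fin expR_ge0.
rewrite -EFinM lee_fin -expRD ler_expR.
have -> : \sum_j \sum_t a j t ^+ 2 =
    4 * mu ^+ 2 * n%:R * \sum_jt (n%:R * p jt) * (p jt * DD jt ^+ 2).
  rewrite pair_bigA/= mulr_sumr; apply: eq_bigr => -[j t] _.
  rewrite /a /DD /= !exprMn -[sg ^+ 2]real_normK ?num_real// hsg; ring.
(* One of the two factors [n] of the square is absorbed here, through [n * weight <= cPi]. *)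
have h1 : \sum_jt (n%:R * p jt) * (p jt * DD jt ^+ 2) <= cPi * N.
  rewrite mulr_sumr; apply: ler_sum => jt _; rewrite ler_wpM2r//.
  by rewrite mulr_ge0 ?sqr_ge0.
move: h1; move: (\sum_jt (n%:R * p jt) * _) => s h1.
have h2 : 4 * meps ^+ 2 * mixing_sum PZ Z T ^+ 2 * (4 * mu ^+ 2 * n%:R * s) <=
    2 * mu ^+ 2 * n%:R * (L * N).
  rewrite [leLHS](_ : _ = 2 * mu ^+ 2 * n%:R *
      (8 * meps ^+ 2 * mixing_sum PZ Z T ^+ 2 * s)); last by ring.
  apply: ler_wpM2l; first by rewrite mulr_ge0// mulr_ge0 ?sqr_ge0.
  apply: (@le_trans _ _ (8 * meps ^+ 2 * mixing_sum PZ Z T ^+ 2 * (cPi * N))).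
    by apply: ler_wpM2l => //; rewrite mulr_ge0 ?sqr_ge0// mulr_ge0 ?sqr_ge0.
  by rewrite mulrA ler_wpM2r.
apply: le_trans (lerD (lexx _) h2) _.
(* Second-order terms: [5 / 2] from the draws plus 2 from [eps]. As [mu * L = 1 / 16], they amount
   to [9 / 32], below the announced [1 / 2]. *)
rewrite /K [leLHS](_ : _ = n%:R * mu * N * (9 / 2 * (mu * L) - sg)); last by field.
apply: ler_wpM2l; last by rewrite muL; lra.
by rewrite mulr_ge0// mulr_ge0// ltW.
Qed.

End risk_moment.

(** * A finite net of the factor classes *)

Section rprod_bounds.
Context (R : realType) (d tau T : nat) (Lambda : 'M[R[i]]_(tau, T)).
Implicit Types U V : 'M[R]_(d, tau).

Lemma rprodB U V : rprod (U - V) Lambda = rprod U Lambda - rprod V Lambda.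
Proof.
apply/matrixP => j t; rewrite /rprod /cprod map_mxB mulmxBl !mxE.
by rewrite raddfB.
Qed.

Lemma Re_le_normc (z : R[i]) : `|complex.Re z| <= ComplexField.Normc.normc z.
Proof.
case: z => a b /=; rewrite -sqrtr_sqr ler_wsqrtr// lerDl sqr_ge0//.
Qed.

Context (mLt : R).
Hypothesis hmLt : (maxe 1 (entry_ratio_sup d Lambda) <= mLt%:E)%E.

Lemma mLt_ge1 : 1 <= mLt.
Proof. by move: hmLt; rewrite ge_max => /andP[]. Qed.

(** The supremum bounded by [mLt] ranges over nonzero matrices, hence the separate case of 0; the
    passage to real parts decreases moduli. *)
Lemma rprod_entry_le U j t : `|rprod U Lambda j t| <= mLt * `|U|.
Proof.
have [->|U0] := eqVneq U 0.
  by rewrite /rprod /cprod map_mx0 mul0mx mxE mxE raddf0 normr0 mulr_ge0// (le_trans ler01 mLt_ge1).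
move: hmLt; rewrite ge_max => /andP[_ hsup].
have : ((cmx_norm (cprod U Lambda) / `|U|)%:E <= mLt%:E)%E.
  by apply: le_trans hsup; apply: ereal_sup_ubound; exists U.
rewrite lee_fin ler_pdivrMr ?normr_gt0//; apply: le_trans.
rewrite /cmx_norm mxE (le_trans (Re_le_normc _))//.
apply: le_trans (ler_mx_entry _ j t); rewrite [X in _ <= `|X|]mxE.
exact: ler_norm.
Qed.

End rprod_bounds.

Section grid.
Context (R : realType).

Lemma nat_cell_cover (n : nat) (y : R) : (0 < n)%N -> 0 <= y <= n%:R ->
  exists i : 'I_n, i%:R <= y <= i%:R + 1.
Proof.
case: n => // n _; elim: n => [|n IH] /andP[y0 yn].
  by exists ord0; rewrite y0 add0r.
have [yn1|yn1] := leP y n.+1%:R.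
  have [|i] := IH; first by rewrite y0.
  by exists (widen_ord (leqnSn _) i).
exists ord_max; rewrite ltW//=; move: yn; rewrite -natr1; lra.
Qed.

(** Midpoints of the [n] intervals of length [2 b / n] that divide [[-b, b]], whence the covering
    radius [b / n]. *)
Definition grid_point (n : nat) (b : R) (i : 'I_n) : R := ((2 * i%:R + 1) / n%:R - 1) * b.

Lemma grid_point_le n b (i : 'I_n) : 0 <= b -> `|grid_point b i| <= b.
Proof.
move=> b0; have n0 : 0 < n%:R :> R by rewrite ltr0n (leq_ltn_trans _ (ltn_ord i)).
rewrite /grid_point normrM (ger0_norm b0) -[leRHS]mul1r ler_wpM2r// ler_norml.
have : (2 * i%:R + 1) / n%:R <= 2 :> R.
  rewrite ler_pdivrMr//.
  have : i.+1%:R <= n%:R :> R by rewrite ler_nat.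
  rewrite -natr1; lra.
have : 0 <= (2 * i%:R + 1) / n%:R :> R by rewrite divr_ge0// ltW.
lra.
Qed.

Lemma grid_point_cover n b x : (0 < n)%N -> 0 < b -> `|x| <= b ->
  exists i : 'I_n, `|x - grid_point b i| <= b / n%:R.
Proof.
move=> n0 b0; rewrite ler_norml => /andP[x1 x2].
have nR : 0 < n%:R :> R by rewrite ltr0n.
have [|i /andP[i1 i2]] := @nat_cell_cover n ((x / b + 1) * (n%:R / 2)) n0.
  have h1 : -1 <= x / b by rewrite ler_pdivlMr// mulN1r.
  have h2 : x / b <= 1 by rewrite ler_pdivrMr// mul1r.
  by apply/andP; split; nra.
exists i; rewrite /grid_point.
rewrite [X in `|X|](_ : _ = ((x / b + 1) * (n%:R / 2) - i%:R - 1 / 2) * (2 * b / n%:R)); last first.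
  by field; rewrite !gt_eqF.
rewrite normrM (ger0_norm (x := 2 * b / n%:R)); last by rewrite divr_ge0 ?mulr_ge0// ltW.
have : `|(x / b + 1) * (n%:R / 2) - i%:R - 1 / 2| <= 1 / 2.
  by rewrite ler_norml; lra.
move=> /(ler_wpM2r (x := 2 * b / n%:R)) h; apply: le_trans (h _) _.
  by rewrite divr_ge0 ?mulr_ge0// ltW.
by rewrite le_eqVlt; apply/orP; left; apply/eqP; field; rewrite gt_eqF.
Qed.

End grid.

Section net.
Context (R : realType) (d k tau n : nat) (m0 mLt : R).
Hypotheses (n0 : (0 < n)%N) (k0 : (0 < k)%N) (hm0 : 0 < m0) (hmLt : 1 <= mLt).

Local Notation b := (Num.sqrt (m0 / (k%:R * mLt))).

Let mLt0 : 0 < mLt. Proof. exact: lt_le_trans ltr01 hmLt. Qed.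

Let b0 : 0 < b.
Proof. by rewrite sqrtr_gt0 divr_gt0// mulr_gt0// ltr0n. Qed.

Let kb2 : k%:R * b ^+ 2 = m0 / mLt.
Proof.
rewrite sqr_sqrtr; last by rewrite divr_ge0 ?mulr_ge0// ltW.
by field; rewrite !gt_eqF// ltr0n.
Qed.

(** The factors are discretized rather than their product, so that the logarithm of the cardinality
    grows like [k * (d + tau)] instead of [d * tau]. *)
Definition net_point (s : 'M['I_n]_(d, k) * 'M['I_n]_(k, tau)) : 'M[R]_(d, tau) :=
  map_mx (@grid_point R n b) s.1 *m map_mx (@grid_point R n b) s.2.

Lemma factor_entry_le (U : 'M[R]_(d, k)) (V : 'M[R]_(k, tau)) j l :
  (forall j l, `|U j l| <= b) -> (forall l t, `|V l t| <= b) ->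
  `|(U *m V) j l| <= m0 / mLt.
Proof.
move=> Ub Vb; rewrite mxE (le_trans (ler_norm_sum _ _ _))//.
rewrite -kb2 mulr_natl -[X in _ *+ X]card_ord -sumr_const; apply: ler_sum => i _.
by rewrite normrM expr2 ler_pM.
Qed.

Lemma factor_class_norm_le A : factor_class k m0 mLt A -> `|A : 'M[R]_(d, tau)| <= m0 / mLt.
Proof.
move=> [U [V [-> Ub Vb]]]; apply: mx_norm_ler => [|i j]; first by rewrite divr_ge0// ltW.
exact: factor_entry_le.
Qed.

Lemma net_point_class s : factor_class k m0 mLt (net_point s).
Proof.
exists (map_mx (@grid_point R n b) s.1), (map_mx (@grid_point R n b) s.2).
by split => // j l; rewrite mxE grid_point_le// ltW.
Qed.

(** Each of the [k] products in an entry moves by at most [2 b^2 / n], and [k b^2 = m0 / mLt]: the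
    radius does not depend on [k], and its factor [1 / mLt] compensates the multiplication by
    [Lambda]. *)
Lemma net_point_cover A : factor_class k m0 mLt A ->
  exists s, `|A - net_point s : 'M[R]_(d, tau)| <= 2 * (m0 / mLt) / n%:R.
Proof.
move=> [U [V [-> Ub Vb]]].
have /choice[f fP] : forall ij : 'I_d * 'I_k,
    exists i : 'I_n, `|U ij.1 ij.2 - grid_point b i| <= b / n%:R.
  by move=> ij; exact: grid_point_cover.
have /choice[g gP] : forall ij : 'I_k * 'I_tau,
    exists i : 'I_n, `|V ij.1 ij.2 - grid_point b i| <= b / n%:R.
  by move=> ij; exact: grid_point_cover.
exists (\matrix_(i, j) f (i, j), \matrix_(i, j) g (i, j)).
apply: mx_norm_ler => [|j l].
  by rewrite divr_ge0// mulr_ge0// divr_ge0// ltW.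
rewrite !mxE -sumrB (le_trans (ler_norm_sum _ _ _))//.
rewrite (_ : 2 * (m0 / mLt) / n%:R = \sum_(i < k) 2 * b ^+ 2 / n%:R); last first.
  by rewrite sumr_const card_ord -mulr_natl -kb2; ring.
apply: ler_sum => i _; rewrite !mxE.
set u := U j i; set w := V i l; set u' := grid_point _ _; set w' := grid_point _ _.
have hu : `|u - u'| <= b / n%:R by exact: (fP (j, i)).
have hw : `|w - w'| <= b / n%:R by exact: (gP (i, l)).
have u'b : `|u'| <= b by rewrite grid_point_le// ltW.
rewrite (_ : u * w - u' * w' = (u - u') * w + u' * (w - w')); last by ring.
rewrite (le_trans (ler_normD _ _))// (normrM (u - u')) (normrM u').
rewrite (_ : 2 * b ^+ 2 / n%:R = b / n%:R * b + b * (b / n%:R)); last by ring.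
by apply: lerD; apply: ler_pM => //; exact: Vb.
Qed.

Lemma card_net : #|{: 'M['I_n]_(d, k) * 'M['I_n]_(k, tau)}| = (n ^ (k * (d + tau)))%N.
Proof.
by rewrite card_prod !card_mx card_ord -expnD mulnDr mulnC.
Qed.

End net.

(** * Comparison of risks and the oracle inequality *)

Section tail_bounds.
Context (d : measure_display) (Omega : measurableType d) (R : realType).
Context (P : probability Omega R).

Lemma measurable_ltr_fun (f : Omega -> R) (a : R) :
  measurable_fun setT f -> measurable [set w | a < f w].
Proof.
move=> mf; rewrite (_ : [set w | _] = f @^-1` `]a, +oo[).
  by rewrite -[X in measurable X]setTI; exact: mf.
by apply/seteqP; split => w /=; rewrite in_itv/= andbT.
Qed.

Lemma exponential_tail (f : Omega -> R) (b t : R) : measurable_fun setT f ->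
  (\int[P]_w (expR (f w))%:E <= (expR b)%:E)%E ->
  (P [set w | (b + t < f w)%R] <= (expR (- t))%:E)%E.
Proof.
move=> mf fb; set A := [set w | _].
have mA : measurable A by exact: measurable_ltr_fun.
rewrite -[X in P X]setIT -integral_indic//.
have mef : measurable_fun setT (fun w => (expR (f w))%:E).
  by apply/measurable_EFinP; apply: measurableT_comp.
apply: (@le_trans _ _ (\int[P]_w ((expR (- (b + t)))%:E * (expR (f w))%:E))%E).
  apply: ge0_le_integral => //.
  - by apply/measurable_EFinP; exact: measurable_indic.
  - exact: measurable_funeM.
  - move=> w _; rewrite -EFinM lee_fin -expRD indicE.
    case: (boolP (w \in A)) => [/set_mem wA|_]; last exact: expR_ge0.
    have {}wA : b + t < f w by exact: wA.
    by rewrite -[leLHS]expR0 ler_expR; lra.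
rewrite ge0_integralZl ?lee_fin ?expR_ge0//.
apply: le_trans (lee_wpmul2l _ fb) _; first by rewrite lee_fin expR_ge0.
by rewrite -EFinM lee_fin -expRD ler_expR; lra.
Qed.

Lemma union_bound (I : finType) (A : I -> set Omega) : (forall i, measurable (A i)) ->
  (P (\bigcup_(i in [set: I]) A i) <= \sum_i P (A i))%E.
Proof.
move=> mA.
have mU : measurable (\bigcup_(i in [set: I]) A i).
  by apply: fin_bigcup_measurable => // i _.
rewrite -[X in (P X <= _)%E]setIT -integral_indic//.
have -> : (\sum_i P (A i) = \int[P]_w \sum_i (\1_(A i) w)%:E)%E.
  rewrite ge0_integral_sum//.
    by apply: eq_bigr => i _; rewrite integral_indic// setIT.
  by move=> i; apply/measurable_EFinP; exact: measurable_indic.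
apply: ge0_le_integral => //.
- by apply/measurable_EFinP; exact: measurable_indic.
- by apply: emeasurable_sum => i; apply/measurable_EFinP; exact: measurable_indic.
- move=> w _; rewrite sumEFin lee_fin indicE.
  case: (boolP (w \in _)) => [/set_mem[i _ Aiw]|_]; last by rewrite sumr_ge0.
  by rewrite (bigD1 i)//= indicE mem_set// lerDl sumr_ge0.
Qed.

End tail_bounds.

Section risk_comparison.
Context (R : realType) (d T n : nat).
Context (X : 'I_n -> 'M[R]_(d, T)) (e : 'M[R]_(d, T)) (x : 'I_n -> R).

Lemma frobD (A B C : 'M[R]_(d, T)) : frob A (B + C) = frob A B + frob A C.
Proof. by rewrite /frob mulmxDr mxtraceD. Qed.

Lemma frobB (A B C : 'M[R]_(d, T)) : frob A (B - C) = frob A B - frob A C.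
Proof. by rewrite /frob mulmxBr raddfB. Qed.

Lemma emp_riskE (Y : 'I_n -> R) (A Theta : 'M[R]_(d, T)) :
  (forall i, Y i = frob (X i) (Theta + e) + x i) ->
  emp_risk X Y A = emp_risk X Y Theta - n%:R^-1 * excess X e x (A - Theta).
Proof.
move=> YE; rewrite /emp_risk /excess -mulrBr -sumrB; congr (_ * _).
apply: eq_bigr => i _; rewrite YE frobD frobB; ring.
Qed.

Hypothesis hX : forall i, exists jt, X i = basis_elt R jt.

Let frob_le i (D : 'M[R]_(d, T)) (b : R) : (forall j t, `|D j t| <= b) ->
  `|frob (X i) D| <= b.
Proof. by move=> Db; have [jt ->] := hX i; rewrite frob_delta. Qed.

(** Each difference of summands has the factor [u1 - u2], at most [h] in absolute value. The noise
    [x] has no uniform bound, so its absolute sum remains and is controlled by an event of its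
    own. *)
Lemma excess_lipschitz (D1 D2 : 'M[R]_(d, T)) (b h m : R) :
  (forall j t, `|D1 j t| <= b) -> (forall j t, `|D2 j t| <= b) ->
  (forall j t, `|D1 j t - D2 j t| <= h) -> (forall j t, `|e j t| <= m) ->
  excess X e x D1 <= excess X e x D2 + 2 * h * \sum_i `|x i| + n%:R * (h * (2 * m + 2 * b)).
Proof.
move=> D1b D2b D12 em; rewrite -addrA -lerBlDl.
have -> : 2 * h * (\sum_i `|x i|) + n%:R * (h * (2 * m + 2 * b)) =
    \sum_i (2 * h * `|x i| + h * (2 * m + 2 * b)).
  by rewrite big_split/= -mulr_sumr sumr_const card_ord (mulr_natl _ n).
rewrite -sumrB; apply: ler_sum => i _.
have f1 := frob_le i D1b; have f2 := frob_le i D2b; have f3 := frob_le i em.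
have f12 : `|frob (X i) D1 - frob (X i) D2| <= h.
  by rewrite -frobB; apply: frob_le => j t; rewrite !mxE.
move: (frob _ D1) (frob _ D2) (frob _ e) f1 f2 f3 f12 => u1 u2 u3 f1 f2 f3 f12.
rewrite [leLHS](_ : _ = (u1 - u2) * (2 * x i + 2 * u3 - (u1 + u2))); last by ring.
rewrite (le_trans (ler_norm _))// normrM.
rewrite [leRHS](_ : _ = h * (2 * `|x i| + 2 * m + (b + b))); last by ring.
apply: ler_pM => //.
rewrite (le_trans (ler_normB _ _))// lerD//.
  by rewrite (le_trans (ler_normD _ _))// lerD// normrM ger0_norm// ler_wpM2l.
by rewrite (le_trans (ler_normD _ _))// lerD.
Qed.

End risk_comparison.

Lemma normPi2_lipschitz (R : realType) (d T : nat) (Pi : probability 'M[R]_(d, T) R)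
    (D1 D2 : 'M[R]_(d, T)) (b h : R) :
  Pi (@basis_mx R d T) = 1%E ->
  (forall j t, `|D1 j t| <= b) -> (forall j t, `|D2 j t| <= b) ->
  (forall j t, `|D1 j t - D2 j t| <= h) ->
  normPi2 Pi D1 <= normPi2 Pi D2 + 2 * b * h.
Proof.
move=> hPi D1b D2b D12; rewrite !normPi2E// -[X in _ + X]mulr1 -[X in _ + _ * X](sum_weight hPi).
rewrite mulr_sumr -big_split/=; apply: ler_sum => jt _.
rewrite -lerBlDl -mulrBr [leRHS]mulrC; apply: ler_wpM2l; first exact: weight_ge0.
move: (D1 _ _) (D2 _ _) (D1b jt.1 jt.2) (D2b jt.1 jt.2) (D12 jt.1 jt.2) => u1 u2 f1 f2 f12.
rewrite subr_sqr (le_trans (ler_norm _))// normrM [leRHS]mulrC.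
apply: ler_pM => //; rewrite (le_trans (ler_normD _ _))//.
by rewrite mulr_natl mulr2n lerD.
Qed.

(** * Size of the constants and deterministic arithmetic of the oracle inequality *)

Section constants.
Context (R : realType) (m0 meps cxi vxi cPi Phi : R).
Hypotheses (hm0 : 0 < m0) (hmeps : 0 < meps) (hcxi : 0 < cxi) (hvxi : 0 < vxi).

(** The common factor of [cst_b1], which is 32 times it, and of [cst_pen], which is twice it. *)
Definition inv_rate : R :=
  (Num.min (1 / cst_a m0 meps vxi cPi Phi) (cst_lambda m0 meps cxi))^-1.

Let a_ge : [/\ 16 * m0 ^+ 2 <= cst_a m0 meps vxi cPi Phi,
  16 * vxi <= cst_a m0 meps vxi cPi Phi,
  16 * meps ^+ 2 <= cst_a m0 meps vxi cPi Phi &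
  8 * meps ^+ 2 * Phi ^+ 2 * cPi <= cst_a m0 meps vxi cPi Phi].
Proof.
rewrite /cst_a; split; rewrite -ler_pdivrMl// !le_max; apply/orP.
- by left; apply/orP; left; lra.
- by left; apply/orP; right; lra.
- by right; apply/orP; left; lra.
- by right; apply/orP; right; lra.
Qed.

Let a_gt0 : 0 < cst_a m0 meps vxi cPi Phi.
Proof. by case: a_ge => h _ _ _; apply: lt_le_trans h; rewrite mulr_gt0// exprn_gt0. Qed.

Let lambda_gt0 : 0 < cst_lambda m0 meps cxi.
Proof. by rewrite invr_gt0 mulr_gt0 ?mulr_gt0// lt_max hm0. Qed.

Let min_gt0 : 0 < Num.min (1 / cst_a m0 meps vxi cPi Phi) (cst_lambda m0 meps cxi).
Proof. by rewrite lt_min lambda_gt0 divr_gt0. Qed.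

Lemma inv_rate_gt0 : 0 < inv_rate. Proof. by rewrite invr_gt0. Qed.

Let rate_a : cst_a m0 meps vxi cPi Phi <= inv_rate.
Proof.
rewrite -[leLHS]invrK lef_pV2 ?posrE ?invr_gt0//.
by rewrite ge_min div1r lexx.
Qed.

Let rate_lambda : 16 * m0 * Num.max m0 (Num.max meps cxi) <= inv_rate.
Proof.
rewrite -[leLHS]invrK lef_pV2 ?posrE ?invr_gt0//; last first.
  by rewrite mulr_gt0 ?mulr_gt0// lt_max hm0.
by rewrite ge_min lexx orbT.
Qed.

Lemma inv_rate_ge : [/\ 16 * m0 ^+ 2 <= inv_rate, 16 * vxi <= inv_rate,
  16 * meps ^+ 2 <= inv_rate, 8 * meps ^+ 2 * Phi ^+ 2 * cPi <= inv_rate &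
  (16 * m0 * meps <= inv_rate) /\ (16 * m0 * cxi <= inv_rate)].
Proof.
case: a_ge => h1 h2 h3 h4.
split; [exact: le_trans rate_a|exact: le_trans rate_a|exact: le_trans rate_a|
        exact: le_trans rate_a|split; apply: le_trans rate_lambda].
- by rewrite ler_wpM2l ?mulr_ge0 ?(ltW hm0)// !le_max lexx orbT.
- by rewrite ler_wpM2l ?mulr_ge0 ?(ltW hm0)// !le_max lexx !orbT.
Qed.

(** The contribution [4 * 5 * cst_b1] alone is 640 times [inv_rate]; 69 is the coefficient of [ell]
    that [oracle_arith] produces. *)
Lemma cst_1_ge (mL : R) : 0 <= mL -> 69 * inv_rate <= cst_1 mL m0 meps cxi vxi cPi Phi.
Proof.
move=> mL0; rewrite /cst_1 /cst_rb /cst_b1 /cst_pen -/inv_rate.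
have L0 := inv_rate_gt0.
have b2 : 0 <= m0 * cst_b2 mL m0 meps cxi vxi.
  rewrite /cst_b2; apply: mulr_ge0; first exact: ltW.
  apply: mulr_ge0; first exact: mulr_ge0.
  have : 0 <= vxi / (2 * cxi) by rewrite divr_ge0 ?mulr_ge0// ltW.
  by have := sqrtr_ge0 vxi; move: hmeps hm0; lra.
have h1 : 0 <= m0 * mL * cxi by rewrite mulr_ge0 ?mulr_ge0// ltW.
have h2 : 0 <= m0 * cxi by rewrite mulr_ge0// ltW.
lra.
Qed.

Lemma cst_2_ge0 (mL : R) : 0 <= mL -> 0 <= cst_2 mL m0 meps cxi vxi.
Proof.
move=> mL0; rewrite /cst_2 /cst_b2; apply: mulr_ge0; last exact: ltW.
apply: mulr_ge0 => //; apply: mulr_ge0; first exact: mulr_ge0.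
have : 0 <= vxi / (2 * cxi) by rewrite divr_ge0 ?mulr_ge0// ltW.
by have := sqrtr_ge0 vxi; move: hmeps hm0; lra.
Qed.

End constants.

Lemma min_overE (R : realType) (E : Type) (D : set E) (f : E -> R) (x : E) :
  is_argmin D f x -> min_over D f = f x.
Proof.
move=> [Dx fx]; apply/eqP; rewrite eq_le; apply/andP; split.
  by apply: ge_inf; [exists (f x) => _ [y Dy <-]; exact: fx|exists x].
by apply: lb_le_inf; [exists (f x), x|move=> _ [y Dy <-]; exact: fx].
Qed.

Lemma ge_min_over (R : realType) (E : Type) (D : set E) (f : E -> R) (b : R) :
  D !=set0 -> (forall x, D x -> b <= f x) -> b <= min_over D f.
Proof.
move=> [x Dx] bf; apply: lb_le_inf; first by exists (f x), x.
by move=> _ [y Dy <-]; exact: bf.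
Qed.

(* [gnet], [ghat] and [gstar] are [n] times the decrease of the empirical risk
   from the true matrix to the net point, to the estimator and to the oracle. *)
Lemma oracle_arith (R : realType) (nR L m0 meps ell lam kd kd' S gnet ghat gstar
    Nnet Nhat Nstar : R) :
  1 <= nR -> 0 < L -> 0 < m0 -> 1 <= ell -> 0 <= lam -> 0 <= kd' ->
  16 * m0 ^+ 2 <= L -> 16 * m0 * meps <= L ->
  let mu := (16 * L)^-1 in let h := 2 * m0 / nR in
  mu * gnet <= nR * mu * Nnet * (1 / 2 - 1) + (kd' * lam + ell) ->
  Nhat <= Nnet + 2 * (2 * m0) * h ->
  ghat <= gnet + 2 * h * S + nR * (h * (2 * meps + 2 * (2 * m0))) ->
  8 * m0 / L * S <= 2 * nR + ell ->
  - (nR^-1 * ghat) + 32 * L * (lam / nR) * kd' <=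
    - (nR^-1 * gstar) + 32 * L * (lam / nR) * kd ->
  - (mu * gstar) <= nR * mu * Nstar * (3 / 2) + ell ->
  Nhat <= 3 * Nstar + (64 * L * kd * lam + 69 * L * ell) / nR.
Proof.
move=> n1 L0 m00 ell1 lam0 kd0 Lm0 Lme mu h H1 H2 H3 H4 H5 H6.
have n0 : 0 < nR by lra.
have mul x : 16 * L * (mu * x) = x by rewrite /mu; field; rewrite gt_eqF.
have nh : nR * h = 2 * m0 by rewrite /h; field; rewrite gt_eqF.
have L16 : 0 < 16 * L by rewrite mulr_gt0.
have {}H1 : nR * Nnet <= - 2 * gnet + 32 * L * (kd' * lam + ell).
  have := ler_wpM2l (ltW L16) H1; rewrite mul mulrDr.
  have -> : 16 * L * (nR * mu * Nnet * (1 / 2 - 1)) =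
      16 * L * (mu * (nR * Nnet * (1 / 2 - 1))) by ring.
  rewrite mul; lra.
have {}H6 : - gstar <= 3 / 2 * (nR * Nstar) + 16 * L * ell.
  have := ler_wpM2l (ltW L16) H6; rewrite mulrN mul mulrDr.
  have -> : 16 * L * (nR * mu * Nstar * (3 / 2)) =
      16 * L * (mu * (nR * Nstar * (3 / 2))) by ring.
  rewrite mul; lra.
have {}H2 : nR * Nhat <= nR * Nnet + 8 * m0 ^+ 2.
  have := ler_wpM2l (ltW n0) H2.
  have -> : nR * (Nnet + 2 * (2 * m0) * h) = nR * Nnet + 4 * m0 * (nR * h) by ring.
  rewrite nh expr2; lra.
have {}H5 : - ghat <= - gstar + 32 * L * lam * kd - 32 * L * lam * kd'.
  have := ler_wpM2l (ltW n0) H5.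
  have E (g k : R) : nR * (- (nR^-1 * g) + 32 * L * (lam / nR) * k) = - g + 32 * L * lam * k.
    by field; rewrite gt_eqF.
  rewrite !E; lra.
have {}H4 : 4 * (h * S) <= L * (2 + ell).
  have := ler_wpM2l (ltW L0) H4.
  have -> : L * (8 * m0 / L * S) = nR * (4 * (h * S)).
    have -> : nR * (4 * (h * S)) = 4 * (nR * h) * S by ring.
    by rewrite nh; field; rewrite gt_eqF.
  move=> H; rewrite -(ler_pM2l n0); apply: le_trans H _.
  have : 0 <= L * ell * (nR - 1) by rewrite mulr_ge0 ?subr_ge0// mulr_ge0//; lra.
  lra.
have {}H3 : ghat <= gnet + 2 * (h * S) + 4 * m0 * meps + 8 * m0 ^+ 2.
  apply: le_trans H3 _.
  have -> : nR * (h * (2 * meps + 2 * (2 * m0))) = nR * h * (2 * meps + 2 * (2 * m0)) by ring.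
  rewrite nh expr2; lra.
(* [H5] enters with weight 2, so the penalty of the selected rank contributes
   [- 64 * L * lam * kd'], twice the logarithmic cost of the net in [H1]; the surplus is dropped. *)
have q0 : 0 <= L * (kd' * lam) by rewrite mulr_ge0 ?(ltW L0)// mulr_ge0.
have q1 : 0 <= L * (ell - 1) by rewrite mulr_ge0 ?(ltW L0)// subr_ge0.
(* Origin of 69: [32 * L * ell] from the net, [32 * L * ell] from the oracle, [L * (2 + ell)] from
   the noise, and [24 * m0 ^+ 2 + 8 * m0 * meps <= 2 * L] from the mesh, with [1 <= ell]. *)
rewrite -(ler_pM2l n0) mulrDr.
have -> : nR * ((64 * L * kd * lam + 69 * L * ell) / nR) = 64 * L * kd * lam + 69 * L * ell.
  by field; rewrite gt_eqF.
lra.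
Qed.

Lemma penalty_arith (R : realType) (r0 x L lam dt k k' ghat gstar : R) :
  r0 - x * ghat + 16 * (2 * L) * lam * k' * dt <=
    r0 - x * gstar + 16 * (2 * L) * lam * k * dt ->
  - (x * ghat) + 32 * L * lam * (k' * dt) <= - (x * gstar) + 32 * L * lam * (k * dt).
Proof. lra. Qed.

(** Weakens the bound for one rank to the stated constants: 3 becomes 12 in front of the bias,
    [64 * L] becomes [4 * c1], [69 * L] becomes [c1], and [c2] is added. *)
Lemma oracle_final (R : realType) (nR L c1 c2 lam ell k dt Nhat Nstar : R) :
  0 < nR -> 0 <= L -> 69 * L <= c1 -> 0 <= c2 -> 0 <= lam -> 0 <= k * dt -> 0 <= ell ->
  0 <= Nstar ->
  Nhat <= 3 * Nstar + (64 * L * (k * dt) * lam + 69 * L * ell) / nR ->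
  Nhat - c2 / nR - c1 / nR * ell <= 4 * (3 * Nstar + c1 * (k * dt) * (lam / nR)).
Proof.
move=> n0 L0 c1L c20 lam0 kd0 ell0 N0 key.
have kl0 : 0 <= k * dt * lam / nR.
  by apply: divr_ge0; [exact: mulr_ge0|exact: ltW].
have el0 : 0 <= ell / nR by rewrite divr_ge0// ltW.
have c2n : 0 <= c2 / nR by rewrite divr_ge0// ltW.
have g1 := ler_wpM2r kl0 c1L; have g2 := ler_wpM2r el0 c1L.
have g3 : 0 <= L * (k * dt * lam / nR) by rewrite mulr_ge0.
apply: (@le_trans _ _ (3 * Nstar + (64 * L * (k * dt) * lam + 69 * L * ell) / nR
    - c1 / nR * ell)); first by rewrite lerD2r; lra.
rewrite (_ : (_ + 69 * L * ell) / nR =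
  64 * (L * (k * dt * lam / nR)) + 69 * L * (ell / nR)); last by ring.
rewrite (_ : c1 * (k * dt) * (lam / nR) = c1 * (k * dt * lam / nR)); last by ring.
rewrite (_ : c1 / nR * ell = c1 * (ell / nR)); last by ring.
lra.
Qed.

Theorem theorem4p1
  (R : realType) (d T tau n : nat)
  (hd : (0 < d)%N) (hT : (0 < T)%N) (htau : (1 <= tau <= T)%N)
  (hn : (1 <= n <= d * T)%N)
  (dO : measure_display) (Omega : measurableType dO) (P : probability Omega R)
  (* X, xi, eps and their joint distribution *)
  (X : 'I_n -> {RV P >-> 'M[R]_(d, T)})
  (xi : 'I_n -> {RV P >-> R})
  (eps : {RV P >-> 'M[R]_(d, T)})
  (Pi : probability 'M[R]_(d, T) R)
  (hPi : Pi (@basis_mx R d T) = 1%E)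
  (hX_iid : iid P X)
  (hX_law : forall i A, measurable A -> distribution P (X i) A = Pi A)
  (hxi_iid : iid P xi)
  (hxi_mean : forall i, ('E_P[xi i] = 0)%E)
  (sigma_xi : R) (hsigma : 0 < sigma_xi)
  (hxi_sd : forall i, ('V_P[xi i] = (sigma_xi ^+ 2)%:E)%E)
  (heps_iid : iid P (fun (j : 'I_d) (w : Omega) => row j (eps w)))
  (heps_mean : forall j t, ('E_P[fun w => eps w j t] = 0)%E)
  (h_indep : mutually_indep P
     (tnth [tuple sigma_gen [set: 'I_n] X; sigma_gen [set: 'I_n] xi;
                  g_sigma_algebra_preimage eps]))
  (* Lambda, m_Lambda(tau), T^0 *)
  (Lambda : 'M[R[i]]_(tau, T))
  (mLt : R)
  (hmLt : (maxe 1 (entry_ratio_sup d Lambda) <= mLt%:E)%E)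
  (m0 : R) (hm0 : 0 < m0)
  (T0 : 'M[R]_(d, tau))
  (hT0_rank : (1 <= \rank T0 <= minn d T)%N)
  (hT0_bound : `|T0| <= m0 / mLt)
  (hT0_real : real_mx (cprod T0 Lambda))
  (* the observations *)
  (Y : 'I_n -> Omega -> R)
  (hY : forall i w,
     Y i w = \tr ((X i w)^T *m (rprod T0 Lambda + eps w)) + xi i w)
  (* (A1) *)
  (dZ : measure_display) (OmegaZ : measurableType dZ)
  (PZ : probability OmegaZ R) (Z : int -> {RV PZ >-> R})
  (hA1 : forall j : 'I_d,
     same_law P (fun w => row j (eps w))
              PZ (fun w => \row_(t < T) Z (t.+1)%:Z w))
  (* (A2) *)
  (meps : R) (hmeps : 0 < meps)
  (hA2_eps : {ae P, forall w, `|eps w| <= meps})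
  (cxi vxi : R) (hcxi : 0 < cxi) (hvxi : 0 < vxi)
  (hA2_xi2 : forall i, ('E_P[fun w => (xi i w ^+ 2)%R] <= vxi%:E)%E)
  (hA2_xiq : forall i (q : nat), (3 <= q)%N ->
     ('E_P[fun w => (`|xi i w| ^+ q)%R]
        <= (vxi * cxi ^+ (q - 2) * (q`!)%:R / 2)%:E)%E)
  (* (A3) *)
  (cPi : R) (hcPi : 0 < cPi)
  (hA3 : forall j t, (Pi [set delta_mx j t] <= (cPi / (d * T)%:R)%:E)%E)
  (* the adaptive estimator *)
  (kstar : nat) (hkstar : (0 < kstar)%N)
  (S : nat -> set 'M[R]_(d, tau))
  (hS : forall k, ranks kstar k -> S k `<=` @factor_class R d k tau m0 mLt)
  (hS_real : forall k U, ranks kstar k -> S k U -> real_mx (cprod U Lambda))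
  (hS_min : forall k, ranks kstar k -> exists U,
     is_argmin (S k) (fun U => normPi2 Pi (rprod (U - T0) Lambda)) U)
  (That : nat -> Omega -> 'M[R]_(d, tau))
  (hThat : forall k w, ranks kstar k ->
     is_argmin (S k)
       (fun U => emp_risk (fun i => X i w) (fun i => Y i w) (rprod U Lambda))
       (That k w))
  (khat : Omega -> nat)
  (hkhat : forall w,
     is_argmin (ranks kstar)
       (fun k => emp_risk (fun i => X i w) (fun i => Y i w)
                          (rprod (That k w) Lambda)
                 + penalty (cst_pen m0 meps cxi vxi cPi (mixing_sum PZ Z T))
                           n d tau k)
       (khat w))
  (alpha : R) (halpha : 0 < alpha < 1)
  (hn_max : (maxn d tau <= n)%N) :
  let Theta0 := rprod T0 Lambda in
  let Thetahat w := rprod (That (khat w) w) Lambda in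
  let c1 := cst_1 (cmx_norm Lambda) m0 meps cxi vxi cPi (mixing_sum PZ Z T) in
  let c2 := cst_2 (cmx_norm Lambda) m0 meps cxi vxi in
  (* the event of the bound holds with (inner) probability at least 1 - alpha *)
  exists E : set Omega,
    [/\ measurable E,
        ((1 - alpha)%:E <= P E)%E &
        forall w, E w ->
          normPi2 Pi (Thetahat w - Theta0) <=
          4 * min_over (ranks kstar) (fun k =>
                3 * min_over (S k)
                      (fun U => normPi2 Pi (rprod (U - T0) Lambda))
                + c1 * k%:R * (d + tau)%:R * (ln n%:R / n%:R))
          + c1 / n%:R * ln (4 * kstar%:R / alpha) + c2 / n%:R].
Proof.
move=> Theta0 Thetahat c1 c2.
set Phi := mixing_sum PZ Z T in c1 hkhat *.
set L := inv_rate m0 meps cxi vxi cPi Phi.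
have [Lm0 Lv Lmeps LPhi [Lm0meps Lc]] := @inv_rate_ge _ m0 meps cxi vxi cPi Phi hm0.
have L0 : 0 < L by exact: inv_rate_gt0.
rewrite -/L in Lm0 Lv Lmeps LPhi Lm0meps Lc.
have [n0 ndT] : (0 < n)%N /\ (n <= d * T)%N by apply/andP.
have nR0 : 0 < n%:R :> R by rewrite ltr0n.
have nR1 : 1 <= n%:R :> R by rewrite ler1n.
have mLt1 : 1 <= mLt := mLt_ge1 hmLt.
have mLt0 : 0 < mLt by lra.
have wgt jt : n%:R * weight Pi jt <= cPi.
  have h : weight Pi jt <= cPi / (d * T)%:R by rewrite -lee_fin weightE; exact: hA3.
  have dT0 : 0 < (d * T)%:R :> R by rewrite ltr0n muln_gt0 hd.
  apply: le_trans (ler_wpM2l (ltW nR0) h) _.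
  by rewrite mulrCA ler_piMr ?(ltW hcPi)// ler_pdivrMr// mul1r ler_nat.
(* Union bounds run over ['I_kstar], whereas ranks start at 1. *)
pose kk (i : 'I_kstar) := i.+1.
have rk i : ranks kstar (kk i) by rewrite /ranks/=; exact: ltn_ord.
pose alph : R := 4 * kstar%:R / alpha.
have [alpha0 alpha1] : 0 < alpha /\ alpha < 1 by apply/andP.
have ks1 : 1 <= kstar%:R :> R by rewrite ler1n.
have alph4 : 4 <= alph by rewrite ler_pdivlMr//; nra.
have alph0 : 0 < alph by lra.
pose ell := ln alph.
(* [expR 1 <= 1 + 1 + 2 <= alph]. Thanks to this bound the constant remainders are absorbed into
   multiples of [ell]. *)
have ell1 : 1 <= ell.
  rewrite -ler_expR lnK ?posrE//; apply: le_trans alph4.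
  have := @expR_le_quadratic R 1 (lexx _); rewrite expr1n; lra.
pose lam : R := ln n%:R.
have lam0 : 0 <= lam by rewrite ln_ge0.
(* The first term is the logarithm of the size of the net of rank [k]: a whole net then costs
   probability [alph^-1]. *)
pose t k := (k * (d + tau))%:R * lam + ell.
have ents (U : 'M[R]_(d, tau)) : `|U| <= m0 / mLt ->
    forall j s, `|rprod (U - T0) Lambda j s| <= 2 * m0.
  move=> Um j s; apply: le_trans (rprod_entry_le hmLt _ _ _) _.
  rewrite (_ : 2 * m0 = mLt * (m0 / mLt + m0 / mLt)); last first.
    by field; rewrite gt_eqF.
  by rewrite ler_pM2l// (le_trans (ler_normB _ _))// lerD.
have Sents k (U : 'M[R]_(d, tau)) : ranks kstar k -> S k U ->
    forall j s, `|rprod (U - T0) Lambda j s| <= 2 * m0.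
  move=> hk SU; apply: ents; have k0 : (0 < k)%N by case/andP: hk.
  exact: (factor_class_norm_le k0 hm0 mLt1 (hS k hk U SU)).
have /choice[Ts hTs] : forall k, exists U : 'M[R]_(d, tau), ranks kstar k ->
    is_argmin (S k) (fun U => normPi2 Pi (rprod (U - T0) Lambda)) U.
  move=> k.
  have [hk|nk] := pselect (ranks kstar k); last by exists 0.
  by have [U hU] := hS_min k hk; exists U.
pose Dn (i : 'I_kstar) (s : 'M['I_n]_(d, kk i) * 'M['I_n]_(kk i, tau)) :=
  rprod (net_point m0 mLt s - T0) Lambda.
have DnB i s j u : `|Dn i s j u| <= 2 * m0.
  apply: ents; apply: (@factor_class_norm_le _ _ (kk i) _ _ _ _ hm0 mLt1) => //.
  exact: net_point_class.
pose Ds (i : 'I_kstar) := rprod (Ts (kk i) - T0) Lambda.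
have DsB i j u : `|Ds i j u| <= 2 * m0.
  by apply: (Sents (kk i)) => //; have [] := hTs _ (rk i).
pose mu := (16 * L)^-1.
pose gap (D : 'M[R]_(d, T)) w := excess (fun i => X i w) (eps w) (fun i => xi i w) D.
have mgap D : measurable_fun setT (gap D) by exact: (@measurable_excess R d T n).
have moment (D : 'M[R]_(d, T)) sg : (forall j u, `|D j u| <= 2 * m0) -> `|sg| = 1 ->
    (\int[P]_w (expR (sg * mu * gap D w))%:E <=
     (expR (n%:R * mu * normPi2 Pi D * (1 / 2 - sg)))%:E)%E.
  move=> DB hsg.
  exact: (risk_moment hPi hX_iid hX_law hxi_iid hxi_mean heps_iid heps_mean
    h_indep hA1 hmeps hA2_eps hcxi hvxi hA2_xi2 hA2_xiq wgt hm0 L0 Lm0 Lv Lmeps Lc LPhi DB hsg).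
have mmu (D : 'M[R]_(d, T)) sg : measurable_fun setT (fun w => sg * mu * gap D w).
  by apply: measurable_funM.
(* The bad events: deviations at the points of the net (A1), at the oracles (A2)
   and of the absolute noise (A3), which controls the discretization error. *)
pose A1 i s := [set w |
  n%:R * mu * normPi2 Pi (Dn i s) * (1 / 2 - 1) + t (kk i) < 1 * mu * gap (Dn i s) w].
pose A2 i := [set w |
  n%:R * mu * normPi2 Pi (Ds i) * (1 / 2 - (-1)) + ell < (-1) * mu * gap (Ds i) w].
(* With the mesh [h = 2 * m0 / n], this is [4 * n * h / L], fitting the doubled discretization
   error; [16 * m0 * cxi <= L] is exactly Bernstein's condition for it. *)
pose sx := 8 * m0 / L.
pose A3 := [set w | 2 * n%:R + ell < sx * \sum_i `|xi i w|].
have mA1 i s : measurable (A1 i s) by exact: measurable_ltr_fun.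
have mA2 i : measurable (A2 i) by exact: measurable_ltr_fun.
have mabs : measurable_fun setT (fun w => sx * \sum_i `|xi i w|).
  apply: measurable_funM => //; apply: measurable_sum => i.
  exact: measurableT_comp.
have mA3 : measurable A3 by exact: measurable_ltr_fun.
have expell : expR (- ell) = alph^-1 by rewrite expRN lnK.
have PA1 i s : (P (A1 i s) <= (((n ^ (kk i * (d + tau)))%N%:R)^-1 * alph^-1)%:E)%E.
  apply: le_trans (exponential_tail (t (kk i)) (mmu _ _) (moment _ 1 (DnB i s) (normr1 _))) _.
  by rewrite lee_fin /t opprD expRD expell expRN expRM_natl lnK// natrX.
have PA2 i : (P (A2 i) <= (alph^-1)%:E)%E.
  rewrite -expell; apply: exponential_tail => //; apply: moment; first exact: DsB.
  by rewrite normrN1.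
have PA3 : (P A3 <= (alph^-1)%:E)%E.
  rewrite -expell; apply: exponential_tail => //.
  apply: (abs_noise_moment hxi_iid hcxi hvxi hxi_mean hA2_xi2 hA2_xiq).
  - by rewrite divr_ge0 ?mulr_ge0 ?(ltW hm0)// ltW.
  - by rewrite /sx mulrAC ler_pdivrMr//; lra.
  - rewrite /sx exprMn exprVn mulrAC ler_pdivrMr ?exprn_gt0//.
    have := ler_pM (mulr_ge0 (ler0n R 16) (sqr_ge0 m0))
      (mulr_ge0 (ler0n R 16) (ltW hvxi)) Lm0 Lv.
    have : 0 <= L * L by rewrite mulr_ge0 ?(ltW L0).
    by rewrite exprMn !expr2; lra.
have [N0 [mN0 PN0 subN0]] : {ae P, forall w, `|eps w| <= meps /\
    exists x, sample_cell X x w}.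
  apply: filterS2 hA2_eps (sample_cell_ae hPi hX_law) => w ew cw.
  by split.
pose B1 := \bigcup_(i in [set: 'I_kstar]) \bigcup_(s in setT) A1 i s.
pose B2 := \bigcup_(i in [set: 'I_kstar]) A2 i.
have mB1' i : measurable (\bigcup_(s in setT) A1 i s).
  by apply: fin_bigcup_measurable => // s _.
have mB1 : measurable B1 by apply: fin_bigcup_measurable => // i _.
have mB2 : measurable B2 by apply: fin_bigcup_measurable => // i _.
pose bad := B1 `|` B2 `|` A3 `|` N0.
have mbad : measurable bad by do 3?[apply: measurableU => //].
(* [kstar / alph = alpha / 4]. With the same for the oracles and at most that for the noise, the
   exceptional set has probability at most [3 * alpha / 4]. *)
have PB1 : (P B1 <= (alpha / 4)%:E)%E.
  apply: le_trans (union_bound _ mB1') _.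
  rewrite (_ : alpha / 4 = \sum_(i < kstar) alph^-1); last first.
    rewrite sumr_const card_ord -mulr_natl /alph; field.
    by rewrite !gt_eqF//; lra.
  rewrite -sumEFin; apply: lee_sum => i _.
  apply: le_trans (union_bound _ (mA1 i)) _.
  apply: le_trans (lee_sum _ (fun s _ => PA1 i s)) _.
  rewrite sumEFin lee_fin sumr_const card_net -[leLHS]mulr_natl mulrA divff ?mul1r//.
  by rewrite pnatr_eq0 -lt0n expn_gt0 n0.
have PB2 : (P B2 <= (alpha / 4)%:E)%E.
  apply: le_trans (union_bound _ mA2) _.
  rewrite (_ : alpha / 4 = \sum_(i < kstar) alph^-1); last first.
    rewrite sumr_const card_ord -mulr_natl /alph; field.
    by rewrite !gt_eqF//; lra.
  by rewrite -sumEFin; apply: lee_sum => i _.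
have alphV : alph^-1 <= alpha / 4.
  by rewrite /alph invf_div ler_pdivrMr ?mulr_gt0 ?ltr0n//; nra.
have U2 (A B : set Omega) : measurable A -> measurable B ->
    (P (A `|` B) <= P A + P B)%E by move=> mA mB; exact: measureU2.
have Pbad : (P bad <= alpha%:E)%E.
  apply: le_trans (U2 _ _ _ mN0) _; first by do 2?[apply: measurableU => //].
  have -> : P N0 = 0%E by exact: PN0.
  rewrite adde0; apply: le_trans (U2 _ _ _ mA3) _; first exact: measurableU.
  apply: le_trans (leeD (U2 _ _ mB1 mB2) PA3) _.
  apply: le_trans (leeD (leeD PB1 PB2) (lexx _)) _.
  by rewrite -!EFinD lee_fin; lra.
exists (~` bad); split; first exact: measurableC.
  rewrite probability_setC// EFinB leeB//.
move=> w /= nbad.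
have nN0 : ~ N0 w by move=> ?; apply: nbad; right.
have nA3 : ~ A3 w by move=> ?; apply: nbad; left; right.
have nA2 i : ~ A2 i w by move=> ?; apply: nbad; left; left; right; exists i.
have nA1 i s : ~ A1 i s w by move=> ?; apply: nbad; do 3 left; exists i => //; exists s.
have [epsw [xw xwE]] : `|eps w| <= meps /\ exists x, sample_cell X x w.
  by apply: contrapT => nE; apply: nN0; exact: subN0.
have basisw i : exists jt, X i w = basis_elt R jt by exists (xw i); exact: xwE.
have epse j u : `|eps w j u| <= meps by exact: le_trans (ler_mx_entry _ _ _) epsw.
have [rkhat khatmin] := hkhat w.
have [SThat Thatmin] := hThat _ w rkhat.
have [ihat ihatE] : exists i, kk i = khat w.
  have /andP[k1 k2] := rkhat.
  have kl : ((khat w).-1 < kstar)%N by rewrite prednK.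
  by exists (Ordinal kl); rewrite /kk /= prednK.
rewrite /Thetahat /Theta0 -rprodB.
set That' := That (khat w) w in SThat Thatmin *.
pose Dhat := rprod (That' - T0) Lambda.
have DhatB : forall j u, `|Dhat j u| <= 2 * m0 by exact: Sents rkhat SThat.
have [s hs] : exists s : 'M['I_n]_(d, kk ihat) * 'M['I_n]_(kk ihat, tau),
    `|That' - net_point m0 mLt s| <= 2 * (m0 / mLt) / n%:R.
  apply: net_point_cover => //; rewrite ihatE; exact: hS SThat.
pose h := 2 * m0 / n%:R.
have Dclose j u : `|Dhat j u - Dn ihat s j u| <= h.
  have -> : Dhat j u - Dn ihat s j u = rprod (That' - net_point m0 mLt s) Lambda j u.
    by rewrite /Dhat /Dn !rprodB !mxE opprB addrA subrK.
  apply: le_trans (rprod_entry_le hmLt _ _ _) _.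
  rewrite (_ : h = mLt * (2 * (m0 / mLt) / n%:R)) ?ler_pM2l//.
  by rewrite /h; field; rewrite !gt_eqF.
have YE i : Y i w = frob (X i w) (rprod T0 Lambda + eps w) + xi i w by exact: hY.
have penE : cst_pen m0 meps cxi vxi cPi Phi = 2 * L by [].
have E32 : 1 / 2 - (-1) = 3 / 2 :> R by field.
(* [r0] is the empirical risk of the true matrix; common to all candidates, it cancels when risks
   are compared. *)
have [r0 riskE] : exists r0 : R, forall U,
    emp_risk (fun i => X i w) (fun i => Y i w) (rprod U Lambda) =
    r0 - n%:R^-1 * gap (rprod (U - T0) Lambda) w.
  by eexists => U; rewrite (emp_riskE _ YE) rprodB.
have mL0 : 0 <= cmx_norm Lambda by exact: normr_ge0.
have c1L : 69 * L <= c1 by exact: cst_1_ge.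
have c20 : 0 <= c2 by exact: cst_2_ge0.
(* Everything but the minimum goes to the left, so that the inequality can be checked rank by
   rank. *)
rewrite -lerBlDr -lerBlDr -ler_pdivrMl//.
apply: ge_min_over; first by exists (khat w).
move=> k hk.
have [i ikE] : exists i, kk i = k.
  have /andP[k1 k2] := hk.
  have kl : (k.-1 < kstar)%N by rewrite prednK.
  by exists (Ordinal kl); rewrite /kk /= prednK.
rewrite (min_overE (hTs k hk)).
have key : normPi2 Pi Dhat <= 3 * normPi2 Pi (Ds i) +
    (64 * L * (k * (d + tau))%:R * lam + 69 * L * ell) / n%:R.
  apply: (@oracle_arith R n%:R L m0 meps ell lam (k * (d + tau))%:R
    (khat w * (d + tau))%:R (\sum_i `|xi i w|) (gap (Dn ihat s) w) (gap Dhat w)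
    (gap (Ds i) w) (normPi2 Pi (Dn ihat s))) => //.
  - have /negP := nA1 ihat s; rewrite -leNgt mul1r -ihatE; exact.
  - exact: normPi2_lipschitz.
  - exact: excess_lipschitz.
  - by have /negP := nA3; rewrite -leNgt.
  (* Two minimizations are chained: [khat w] against [k], then [That k w] against the oracle
     [Ts k]. *)
  - have h1 := khatmin k hk.
    have [STs Tsmin] := hThat k w hk.
    have h2 := Tsmin (Ts k) (hTs k hk).1.
    have := le_trans h1 (lerD h2 (lexx _)).
    rewrite (riskE That') (riskE (Ts k)) /penalty penE -/Dhat -{1}ikE -/(Ds i).
    by rewrite -/lam !natrM => /penalty_arith.
  - by have /negP := nA2 i; rewrite -leNgt mulN1r mulNr E32.
rewrite -ikE -/(Ds i) ikE -/Dhat -/lam -/alph -/ell.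
rewrite natrM in key; rewrite ler_pdivrMl//.
rewrite -[c1 * k%:R * (d + tau)%:R]mulrA.
apply: oracle_final key => //.
- exact: ltW.
- exact: le_trans ler01 ell1.
- by rewrite normPi2E//; apply: sumr_ge0 => jt _; rewrite mulr_ge0 ?weight_ge0 ?sqr_ge0.
Qed.
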